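(* Let $T>0$ and let $f,g:[0,T]\times\mathbb{R}^4\to\mathbb{R}$ be continuous functions. Consider the periodic problem $$z''(t)=f(t,z(t),w(t),z'(t),w'(t)),\qquad w''(t)=g(t,z(t),w(t),z'(t),w'(t)),\qquad t\in[0,T],$$ $$z(0)=z(T),\quad z'(0)=z'(T),\quad w(0)=w(T),\quad w'(0)=w'(T).$$ Suppose that $(\alpha_1,\alpha_2)$ is a lower solution and $(\beta_1,\beta_2)$ is an upper solution of this problem (in the sense defined in the context; no order relation between $\alpha_i$ and $\beta_i$ is assumed), and put $\alpha_i^0(t)=\alpha_i(t)-\|\alpha_i\|$, $\beta_i^0(t)=\beta_i(t)+\|\beta_i\|$ for $i=1,2$. Suppose that $f,g$ satisfy a Nagumo-type condition relative to the intervals $[\alpha_1^0(t),\beta_1^0(t)]$ and $[\alpha_2^0(t),\beta_2^0(t)]$, $t\in[0,T]$. Suppose moreover that: (i) for all fixed $t\in[0,T]$, $z_0\in\mathbb{R}$, $w_1\in\mathbb{R}$ and all fixed $z_1$ with $$\min\Big\{\min_{t\in[0,T]}\alpha_1'(t),\min_{t\in[0,T]}\beta_1'(t)\Big\}\le z_1\le\max\Big\{\max_{t\in[0,T]}\alpha_1'(t),\max_{t\in[0,T]}\beta_1'(t)\Big\},$$ the function $w_0\mapsto f(t,z_0,w_0,z_1,w_1)$ is non-increasing on $\mathbb{R}$; (ii) for all fixed $t\in[0,T]$, $w_0\in\mathbb{R}$, $z_1\in\mathbb{R}$ and all fixed $w_1$ with $$\min\Big\{\min_{t\in[0,T]}\alpha_2'(t),\min_{t\in[0,T]}\beta_2'(t)\Big\}\le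 w_1\le\max\Big\{\max_{t\in[0,T]}\alpha_2'(t),\max_{t\in[0,T]}\beta_2'(t)\Big\},$$ the function $z_0\mapsto g(t,z_0,w_0,z_1,w_1)$ is non-increasing on $\mathbb{R}$. Then there exists at least one pair $(z,w)\in(C^2[0,T])^2$ that is a solution of the periodic problem and satisfies $$\alpha_1^0(t)\le z(t)\le\beta_1^0(t),\qquad \alpha_2^0(t)\le w(t)\le\beta_2^0(t),\qquad\forall t\in[0,T].$$
   Context: For a continuous function $u:[0,T]\to\mathbb{R}$, $\|u\|:=\max_{t\in[0,T]}|u(t)|$. Derivatives at the endpoints of $[0,T]$ are one-sided. Lower solution: a pair $(\alpha_1,\alpha_2)\in(C^1[0,T])^2$ of real functions, twice differentiable on $[0,T]$, such that for all $t\in[0,T]$ $$\alpha_1''(t)\ge f(t,\alpha_1^0(t),\alpha_2^0(t),\alpha_1'(t),w_1)\ \ \forall w_1\in\mathbb{R},\qquad \alpha_2''(t)\ge g(t,\alpha_1^0(t),\alpha_2^0(t),z_1,\alpha_2'(t))\ \ \forall z_1\in\mathbb{R},$$ where $\alpha_i^0(t):=\alpha_i(t)-\|\alpha_i\|$, and $\alpha_i(0)=\alpha_i(T)$, $\alpha_i'(0)\ge\alpha_i'(T)$ for $i=1,2$. Upper solution: a pair $(\beta_1,\beta_2)\in(C^1[0,T])^2$ of real functions, twice differentiable on $[0,T]$, such that for all $t\in[0,T]$ $$\beta_1''(t)\le f(t,\beta_1^0(t),\beta_2^0(t),\beta_1'(t),w_1)\ \ \forall w_1\in\mathbb{R},\qquad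 \beta_2''(t)\le g(t,\beta_1^0(t),\beta_2^0(t),z_1,\beta_2'(t))\ \ \forall z_1\in\mathbb{R},$$ where $\beta_i^0(t):=\beta_i(t)+\|\beta_i\|$, and $\beta_i(0)=\beta_i(T)$, $\beta_i'(0)\le\beta_i'(T)$ for $i=1,2$. Nagumo-type condition: given $C^1$ functions $\gamma_i,\Gamma_i:[0,T]\to\mathbb{R}$, $i=1,2$, let $$S=\{(t,z_0,w_0,z_1,w_1)\in[0,T]\times\mathbb{R}^4:\gamma_1(t)\le z_0\le\Gamma_1(t),\ \gamma_2(t)\le w_0\le\Gamma_2(t)\}.$$ Continuous functions $f,g:[0,T]\times\mathbb{R}^4\to\mathbb{R}$ satisfy a Nagumo-type condition relative to the intervals $[\gamma_1(t),\Gamma_1(t)]$ and $[\gamma_2(t),\Gamma_2(t)]$, $t\in[0,T]$, if there exist continuous functions $\varphi,\psi:[0,+\infty)\to(0,+\infty)$ with $$\int_0^{+\infty}\frac{ds}{\varphi(s)}=+\infty,\qquad\int_0^{+\infty}\frac{ds}{\psi(s)}=+\infty,$$ such that $|f(t,z_0,w_0,z_1,w_1)|\le\varphi(|z_1|)$ and $|g(t,z_0,w_0,z_1,w_1)|\le\psi(|w_1|)$ for all $(t,z_0,w_0,z_1,w_1)\in S$. *)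

(* Defs.v *)
From Stdlib Require Import Reals Lra.
From Coquelicot Require Import Coquelicot.
Open Scope R_scope.

(* Functions on [0,T] (resp. [0,T] x R^4) are total Rocq functions of which
   only the values on [0,T] (resp. for t in [0,T]) are ever used: continuity
   and differentiability are taken relative to the set. *)
Definition Icc (T t : R) : Prop := 0 <= t <= T.

(* Limit of the difference quotient over s in [0,T], s <> t; hence one-sided
   at t = 0 and t = T. *)
Definition is_derive_Icc (T : R) (u : R -> R) (t l : R) : Prop :=
  D_in u (fun _ => l) (Icc T) t.

Definition ex_derive_Icc (T : R) (u : R -> R) (t : R) : Prop :=
  exists l, is_derive_Icc T u t l.

Definition Derive_Icc (T : R) (u : R -> R) (t : R) : R :=
  iota (is_derive_Icc T u t).

Definition C1_Icc (T : R) (u : R -> R) : Prop :=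
  (forall t, Icc T t -> ex_derive_Icc T u t) /\
  continuous_on (Icc T) (Derive_Icc T u).

Definition twice_derivable_Icc (T : R) (u : R -> R) : Prop :=
  forall t, Icc T t -> ex_derive_Icc T u t /\ ex_derive_Icc T (Derive_Icc T u) t.

Definition C2_Icc (T : R) (u : R -> R) : Prop :=
  C1_Icc T u /\ C1_Icc T (Derive_Icc T u).

(* Defined as a supremum (infimum); attained for continuous functions, see
   max_Icc_spec and min_Icc_spec. *)
Definition max_Icc (T : R) (u : R -> R) : R :=
  real (Lub_Rbar (fun y => exists t, Icc T t /\ y = u t)).

Definition min_Icc (T : R) (u : R -> R) : R :=
  real (Glb_Rbar (fun y => exists t, Icc T t /\ y = u t)).

Definition norm_Icc (T : R) (u : R -> R) : R :=
  max_Icc T (fun t => Rabs (u t)).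

Definition shift_down (T : R) (a : R -> R) (t : R) : R := a t - norm_Icc T a.
Definition shift_up (T : R) (b : R -> R) (t : R) : R := b t + norm_Icc T b.

(* Arguments of a right-hand side: t, z, w, z', w'. *)
Definition rhs : Type := R -> R -> R -> R -> R -> R.

Definition continuous_rhs (T : R) (f : rhs) : Prop :=
  continuous_on
    (fun p : R * R * R * R * R => let '(t, _, _, _, _) := p in Icc T t)
    (fun p => let '(t, z0, w0, z1, w1) := p in f t z0 w0 z1 w1).

Definition lower_solution (T : R) (f g : rhs) (a1 a2 : R -> R) : Prop :=
  C1_Icc T a1 /\ C1_Icc T a2 /\
  twice_derivable_Icc T a1 /\ twice_derivable_Icc T a2 /\
  (forall t, Icc T t ->
     (forall w1, Derive_Icc T (Derive_Icc T a1) t >=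
        f t (shift_down T a1 t) (shift_down T a2 t) (Derive_Icc T a1 t) w1) /\
     (forall z1, Derive_Icc T (Derive_Icc T a2) t >=
        g t (shift_down T a1 t) (shift_down T a2 t) z1 (Derive_Icc T a2 t))) /\
  a1 0 = a1 T /\ Derive_Icc T a1 0 >= Derive_Icc T a1 T /\
  a2 0 = a2 T /\ Derive_Icc T a2 0 >= Derive_Icc T a2 T.

Definition upper_solution (T : R) (f g : rhs) (b1 b2 : R -> R) : Prop :=
  C1_Icc T b1 /\ C1_Icc T b2 /\
  twice_derivable_Icc T b1 /\ twice_derivable_Icc T b2 /\
  (forall t, Icc T t ->
     (forall w1, Derive_Icc T (Derive_Icc T b1) t <=
        f t (shift_up T b1 t) (shift_up T b2 t) (Derive_Icc T b1 t) w1) /\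
     (forall z1, Derive_Icc T (Derive_Icc T b2) t <=
        g t (shift_up T b1 t) (shift_up T b2 t) z1 (Derive_Icc T b2 t))) /\
  b1 0 = b1 T /\ Derive_Icc T b1 0 <= Derive_Icc T b1 T /\
  b2 0 = b2 T /\ Derive_Icc T b2 0 <= Derive_Icc T b2 T.

(* A continuous map [0,+oo) -> (0,+oo) whose reciprocal has infinite improper
   integral. *)
Definition nagumo_function (phi : R -> R) : Prop :=
  continuous_on (fun s => 0 <= s) phi /\
  (forall s, 0 <= s -> 0 < phi s) /\
  is_lim (fun x => RInt (fun s => / phi s) 0 x) p_infty p_infty.

Definition nagumo_condition (T : R) (f g : rhs) (c1 C1 c2 C2 : R -> R) : Prop :=
  exists phi psi : R -> R,
    nagumo_function phi /\ nagumo_function psi /\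
    forall t z0 w0 z1 w1, Icc T t ->
      c1 t <= z0 <= C1 t -> c2 t <= w0 <= C2 t ->
      Rabs (f t z0 w0 z1 w1) <= phi (Rabs z1) /\
      Rabs (g t z0 w0 z1 w1) <= psi (Rabs w1).

Definition periodic_solution (T : R) (f g : rhs) (z w : R -> R) : Prop :=
  (forall t, Icc T t ->
     Derive_Icc T (Derive_Icc T z) t =
       f t (z t) (w t) (Derive_Icc T z t) (Derive_Icc T w t) /\
     Derive_Icc T (Derive_Icc T w) t =
       g t (z t) (w t) (Derive_Icc T z t) (Derive_Icc T w t)) /\
  z 0 = z T /\ Derive_Icc T z 0 = Derive_Icc T z T /\
  w 0 = w T /\ Derive_Icc T w 0 = Derive_Icc T w T.

Lemma Derive_Icc_unique (T : R) (u : R -> R) (t l : R) :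
  0 < T -> Icc T t -> is_derive_Icc T u t l -> Derive_Icc T u t = l.
Proof.
intros HT [Ht0 HtT] Hl.
assert (Huniq : forall m, is_derive_Icc T u t m -> m = l).
{ intros m Hm.
  apply (single_limit (fun x => (u x - u t) / (x - t)) (D_x (Icc T) t) m l t);
    [ | exact Hm | exact Hl].
  intros e He.
  destruct (Rlt_dec t T) as [HlT|HlT].
  - exists (t + Rmin (T - t) (e / 2)).
    assert (H1 := Rmin_l (T - t) (e / 2)). assert (H2 := Rmin_r (T - t) (e / 2)).
    assert (H3 : 0 < Rmin (T - t) (e / 2)) by (apply Rmin_pos; lra).
    repeat split; try lra. unfold Rdist. rewrite Rabs_pos_eq; lra.
  - exists (t - Rmin t (e / 2)).
    assert (H1 := Rmin_l t (e / 2)). assert (H2 := Rmin_r t (e / 2)).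
    assert (H3 : 0 < Rmin t (e / 2)) by (apply Rmin_pos; lra).
    repeat split; try lra. unfold Rdist. rewrite Rabs_left; lra. }
apply Huniq.
unfold Derive_Icc. apply (iota_correct (V := R_CompleteNormedModule) (is_derive_Icc T u t)).
exists l. split; [exact Hl|]. intros m Hm. symmetry. now apply Huniq.
Qed.

Lemma max_Icc_spec (T : R) (u : R -> R) :
  0 <= T -> continuous_on (Icc T) u ->
  (exists t, Icc T t /\ u t = max_Icc T u) /\
  (forall t, Icc T t -> u t <= max_Icc T u).
Proof.
intros HT Hu.
pose (k := fun t => Rmax 0 (Rmin t T)).
assert (kI : forall t, Icc T (k t)).
{ intros t. unfold k, Icc. split; [apply Rmax_l|].
  apply Rmax_lub; [lra | apply Rmin_r]. }
assert (kid : forall t, Icc T t -> k t = t).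
{ intros t [H0 H1]. unfold k. rewrite Rmin_left, Rmax_right; lra. }
assert (kc : forall t s, Rabs (k s - k t) <= Rabs (s - t)).
{ intros t s. unfold k, Rmax, Rmin, Rabs.
  repeat (destruct Rle_dec || destruct Rcase_abs); lra. }
destruct (continuity_ab_maj (fun t => u (k t)) 0 T HT) as [m [Hm HmI]].
{ intros c _. apply continuity_pt_filterlim.
  assert (Hc := Hu (k c) (kI c)).
  intros P HP. specialize (Hc P HP). destruct Hc as [d Hd].
  exists d. intros y Hy. apply Hd; [|apply kI].
  apply Rle_lt_trans with (2 := Hy). apply kc. }
assert (E : max_Icc T u = u m).
{ unfold max_Icc.
  rewrite (is_lub_Rbar_unique _ (Finite (u m))); [reflexivity|].
  split.
  - intros y [t [Ht ->]]. simpl. specialize (Hm t Ht).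
    cbv beta in Hm. rewrite (kid t Ht), (kid m HmI) in Hm. exact Hm.
  - intros b Hb. apply Hb. exists m. split; [exact HmI|reflexivity]. }
rewrite E. split.
- exists m. split; [exact HmI|reflexivity].
- intros t Ht. specialize (Hm t Ht).
  cbv beta in Hm. rewrite (kid t Ht), (kid m HmI) in Hm. exact Hm.
Qed.

Lemma min_Icc_spec (T : R) (u : R -> R) :
  0 <= T -> continuous_on (Icc T) u ->
  (exists t, Icc T t /\ u t = min_Icc T u) /\
  (forall t, Icc T t -> min_Icc T u <= u t).
Proof.
intros HT Hu.
destruct (max_Icc_spec T (fun t => - u t) HT) as [[m [HmI Hm]] HM].
{ intros t Ht. apply (filterlim_comp _ _ _ u Ropp _ (locally (u t)));
    [exact (Hu t Ht) | apply (filterlim_opp (u t))]. }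
rewrite <- Hm in HM.
assert (E : min_Icc T u = u m).
{ unfold min_Icc.
  rewrite (is_glb_Rbar_unique _ (Finite (u m))); [reflexivity|].
  split.
  - intros y [t [Ht ->]]. simpl. specialize (HM t Ht). lra.
  - intros b Hb. apply Hb. exists m. split; [exact HmI|reflexivity]. }
rewrite E. split.
- exists m. split; [exact HmI|reflexivity].
- intros t Ht. specialize (HM t Ht). lra.
Qed.

(* Main.v *)
Require Import Defs.
From Stdlib Require Import Reals ZArith Lra Lia Classical IndefiniteDescription
  FunctionalExtensionality.
From Coquelicot Require Import Coquelicot.
From mathcomp.classical Require filter.
From mathcomp.boot Require ssrnat.
Open Scope R_scope.

(* Truncate: in f and g replace z, w by their projections on [alpha^0, beta^0]
   and z', w' by their projections on [-N, N], and add the penalty z - proj z to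
   z''.  At a negative minimum of z - alpha_1^0 the truncated z' equals alpha_1',
   so monotonicity in the other unknown and the differential inequality give
   (z - alpha_1^0)'' < 0, a contradiction; likewise for the other three bounds.
   The Nagumo condition makes Phi(z'), with Phi' = 1/phi, 1-Lipschitz in time;
   as z' vanishes somewhere, |z'| < N as soon as Phi(N) > T, so that the solution
   of the truncated problem solves the original one.

   In the coordinates p = z' - z, q = z' + z the truncated system reads
   p' = -p + P, q' = q + P with P bounded.  An explicit Euler polygon maps the
   initial value in a large cube inwards in the directions p and outwards in the
   directions q, so the Poincare-Miranda theorem gives (almost) periodic
   polygons; their limit along an ultrafilter is a periodic solution.

   Poincare-Miranda comes from a cubical Sperner lemma: for 0/1 labels l_i on a
   grid with l_i = 0 (resp. 1) on the face x_i = 0 (resp. x_i = N), the mod 2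
   discrete form dl_1 ... dl_n = d(l_1 dl_2 ... dl_n) has, by Stokes and induction
   on n, integral 1, hence is nonzero on some cell. *)

(** * Discrete differential forms modulo 2 and the cubical Sperner lemma *)

(* An element (a, b) of [form (S m)] stands for a(t) + b(t) dt, where t is the first
   coordinate and a(t), b(t) are forms in the remaining ones. *)
Fixpoint form (n : nat) : Type :=
  match n with
  | O => bool
  | S m => ((nat -> form m) * (nat -> form m))%type
  end.

Fixpoint fzero (n : nat) : form n :=
  match n with
  | O => false
  | S m => (fun _ => fzero m, fun _ => fzero m)
  end.

Fixpoint fone (n : nat) : form n :=
  match n with
  | O => true
  | S m => (fun _ => fone m, fun _ => fzero m)
  end.

Fixpoint fadd (n : nat) : form n -> form n -> form n :=
  match n with
  | O => xorb
  | S m => fun u v => (fun t => fadd m (fst u t) (fst v t),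
                       fun t => fadd m (snd u t) (snd v t))
  end.

(* The shift in [fst v (S t)] encodes the rule dt a(t) = a(t+1) dt, which makes the
   Leibniz rule for finite differences exact. *)
Fixpoint fmul (n : nat) : form n -> form n -> form n :=
  match n with
  | O => andb
  | S m => fun u v =>
      (fun t => fmul m (fst u t) (fst v t),
       fun t => fadd m (fmul m (fst u t) (snd v t))
                       (fmul m (snd u t) (fst v (S t))))
  end.

(** The discrete exterior derivative: differentiation in [t] is the forward difference, and working
    modulo 2 removes every sign. *)
Fixpoint fdiff (n : nat) : form n -> form n :=
  match n with
  | O => fun _ => false
  | S m => fun u =>
      (fun t => fdiff m (fst u t),
       fun t => fadd m (fdiff m (snd u t)) (fadd m (fst u (S t)) (fst u t)))
  end.

Arguments fadd {n}. Arguments fmul {n}. Arguments fdiff {n}.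

(** Addition is pointwise, so an identity involving only [fadd] passes from booleans to every
    dimension by induction. *)
Ltac additive n :=
  induction n as [|n IH]; simpl; intros;
  [ repeat match goal with b : bool |- _ => destruct b end; reflexivity
  | f_equal; extensionality t; apply IH ].

Lemma fadd_0_l n : forall u : form n, fadd (fzero n) u = u.
Proof.
  induction n as [|n IH]; simpl; [reflexivity|].
  intros [a b]; simpl; f_equal; extensionality t; apply IH.
Qed.

Lemma fadd_comm n : forall u v : form n, fadd u v = fadd v u.
Proof. additive n. Qed.

Lemma fadd_0_r n (u : form n) : fadd u (fzero n) = u.
Proof. rewrite fadd_comm; apply fadd_0_l. Qed.

Lemma fadd_diag n : forall u : form n, fadd u u = fzero n.
Proof. additive n. Qed.

Lemma fadd_swap n : forall a b c d : form n,
  fadd (fadd a b) (fadd c d) = fadd (fadd a c) (fadd b d).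
Proof. additive n. Qed.

Lemma fmul_0_l n : forall u : form n, fmul (fzero n) u = fzero n.
Proof.
  induction n as [|n IH]; simpl; intros; [reflexivity|].
  f_equal; extensionality t; rewrite ?IH, ?fadd_diag; reflexivity.
Qed.

Lemma fmul_0_r n : forall u : form n, fmul u (fzero n) = fzero n.
Proof.
  induction n as [|n IH]; simpl; intros; [destruct u; reflexivity|].
  f_equal; extensionality t; rewrite ?IH, ?fadd_diag; reflexivity.
Qed.

Lemma fmul_1_l n : forall u : form n, fmul (fone n) u = u.
Proof.
  induction n as [|n IH]; simpl; [reflexivity|].
  intros [a b]; simpl; f_equal; extensionality t;
    rewrite ?IH, ?fmul_0_l, ?fadd_0_r; reflexivity.
Qed.

Lemma fmul_add_l n : forall u v w : form n,
  fmul (fadd u v) w = fadd (fmul u w) (fmul v w).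
Proof.
  induction n as [|n IH]; simpl; intros; [destruct u, v, w; reflexivity|].
  f_equal; extensionality t; rewrite !IH; [reflexivity|apply fadd_swap].
Qed.

Lemma fmul_add_r n : forall u v w : form n,
  fmul u (fadd v w) = fadd (fmul u v) (fmul u w).
Proof.
  induction n as [|n IH]; simpl; intros; [destruct u, v, w; reflexivity|].
  f_equal; extensionality t; rewrite !IH; [reflexivity|apply fadd_swap].
Qed.

Lemma fdiff_add n : forall u v : form n, fdiff (fadd u v) = fadd (fdiff u) (fdiff v).
Proof.
  induction n as [|n IH]; simpl; intros; [reflexivity|].
  f_equal; extensionality t; rewrite IH; [reflexivity|].
  rewrite (fadd_swap n (fst u (S t))). apply fadd_swap.
Qed.

Lemma fdiff_zero n : fdiff (fzero n) = fzero n.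
Proof.
  induction n as [|n IH]; simpl; [reflexivity|].
  rewrite IH, !fadd_diag. reflexivity.
Qed.

Lemma fdiff_one n : fdiff (fone n) = fzero n.
Proof.
  induction n as [|n IH]; simpl; [reflexivity|].
  rewrite IH, fdiff_zero, !fadd_diag. reflexivity.
Qed.

(** The mixed terms, forward difference in [t] of a differential in the other coordinates and
    conversely, occur twice and cancel modulo 2. *)
Lemma fdiff_fdiff n : forall u : form n, fdiff (fdiff u) = fzero n.
Proof.
  induction n as [|n IH]; simpl; intros; [reflexivity|].
  f_equal; extensionality t; [apply IH|].
  rewrite !fdiff_add, IH, fadd_0_l. apply fadd_diag.
Qed.

(** Bookkeeping for the [dt] component of the Leibniz rule: [x], [y], [z] stand for a(t+1)c(t+1),
    a(t)c(t) and a(t)c(t+1), where a and c are the [fst] parts of the two factors. The cross term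
    [z] comes in twice and cancels. *)
Lemma leibniz_shuffle n : forall u1 u2 u3 u4 x y z : form n,
  fadd (fadd (fadd u1 u2) (fadd u3 u4)) (fadd x y) =
  fadd (fadd u1 (fadd u3 (fadd x z))) (fadd (fadd u2 (fadd z y)) u4).
Proof. additive n. Qed.

Lemma fdiff_mul n : forall u v : form n,
  fdiff (fmul u v) = fadd (fmul (fdiff u) v) (fmul u (fdiff v)).
Proof.
  induction n as [|n IH]; simpl; intros; [destruct v; destruct u; reflexivity|].
  f_equal; extensionality t; [apply IH|].
  rewrite fdiff_add, !IH, !fmul_add_l, !fmul_add_r. apply leibniz_shuffle.
Qed.

(** * Boxes, integration and the Stokes formula for forms modulo 2 *)

Definition scons (t : nat) (x : nat -> nat) (i : nat) : nat :=
  match i with O => t | S j => x j end.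
Definition stail (x : nat -> nat) (i : nat) : nat := x (S i).

(* The form vanishes on the box of lower corner [lo] and upper corner [hi]; such forms
   are an ideal stable under [fdiff].  Used for faces ([lo i = hi i]) and for cells. *)
Fixpoint vanish (n : nat) (lo hi : nat -> nat) : form n -> Prop :=
  match n with
  | O => fun u => u = false
  | S m => fun u =>
      (forall t, (lo O <= t <= hi O)%nat ->
         vanish m (stail lo) (stail hi) (fst u t)) /\
      (forall t, (lo O <= t < hi O)%nat ->
         vanish m (stail lo) (stail hi) (snd u t))
  end.

Lemma vanish_add n : forall lo hi u v,
  vanish n lo hi u -> vanish n lo hi v -> vanish n lo hi (fadd u v).
Proof.
  induction n as [|n IH]; simpl; intros lo hi u v.
  - intros -> ->; reflexivity.
  - intros [H1 H2] [H3 H4]; split; intros; apply IH; auto.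
Qed.

Lemma vanish_mul_l n : forall lo hi u v,
  vanish n lo hi u -> vanish n lo hi (fmul u v).
Proof.
  induction n as [|n IH]; simpl; intros lo hi u v.
  - intros ->; reflexivity.
  - intros [H1 H2]; split; intros t Ht.
    + apply IH, H1, Ht.
    + apply vanish_add; apply IH; [apply H1; lia|apply H2; lia].
Qed.

Lemma vanish_mul_r n : forall lo hi u v,
  vanish n lo hi v -> vanish n lo hi (fmul u v).
Proof.
  induction n as [|n IH]; simpl; intros lo hi u v.
  - intros ->; destruct u; reflexivity.
  - intros [H1 H2]; split; intros t Ht.
    + apply IH, H1, Ht.
    + apply vanish_add; apply IH; [apply H2; lia|apply H1; lia].
Qed.

Lemma vanish_fdiff n : forall lo hi u, vanish n lo hi u -> vanish n lo hi (fdiff u).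
Proof.
  induction n as [|n IH]; simpl; intros lo hi u; [reflexivity|].
  intros [H1 H2]; split; intros t Ht.
  - apply IH, H1, Ht.
  - apply vanish_add; [apply IH, H2, Ht|].
    apply vanish_add; apply H1; lia.
Qed.

Fixpoint xsum (N : nat) (h : nat -> bool) : bool :=
  match N with O => false | S k => xorb (xsum k h) (h k) end.

(** Only the top-degree coefficient is integrated, as a sum modulo 2 over the N^n cells of the
    grid. *)
Fixpoint integral (N n : nat) : form n -> bool :=
  match n with
  | O => fun u => u
  | S m => fun u => xsum N (fun t => integral N m (snd u t))
  end.

Lemma xsum_add N h k : xsum N (fun t => xorb (h t) (k t)) = xorb (xsum N h) (xsum N k).
Proof.
  induction N as [|N IH]; simpl; [reflexivity|]. rewrite IH.
  destruct (xsum N h), (xsum N k), (h N), (k N); reflexivity.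
Qed.

Lemma xsum_false N h : (forall t, (t < N)%nat -> h t = false) -> xsum N h = false.
Proof.
  induction N as [|N IH]; simpl; intros H; [reflexivity|].
  rewrite IH, H; auto.
Qed.

Lemma xsum_telescope N h : xsum N (fun t => xorb (h (S t)) (h t)) = xorb (h N) (h O).
Proof.
  induction N as [|N IH]; simpl; [destruct (h O); reflexivity|]. rewrite IH.
  destruct (h (S N)), (h N), (h O); reflexivity.
Qed.

Lemma xsum_true N h : xsum N h = true -> exists t, (t < N)%nat /\ h t = true.
Proof.
  induction N as [|N IH]; simpl; intros H; [discriminate|].
  destruct (h N) eqn:E; [exists N; auto|].
  destruct IH as [t [Ht Et]]; [destruct (xsum N h); auto|]. exists t; auto.
Qed.

Lemma integral_add N n : forall u v : form n,
  integral N n (fadd u v) = xorb (integral N n u) (integral N n v).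
Proof.
  induction n as [|n IH]; simpl; intros; [reflexivity|].
  rewrite <- xsum_add. f_equal. extensionality t. apply IH.
Qed.

Lemma integral_true N n : forall u : form n, integral N n u = true ->
  exists v, (forall i, (i < n)%nat -> (v i < N)%nat) /\ ~ vanish n v (fun i => S (v i)) u.
Proof.
  induction n as [|n IH]; simpl; intros u H.
  - exists (fun _ => O). split; [lia|]. rewrite H; discriminate.
  - destruct (xsum_true _ _ H) as [t [Ht Et]].
    destruct (IH _ Et) as [v [Hv Nv]].
    exists (scons t v). split.
    + intros [|i] Hi; simpl; [exact Ht|apply Hv; lia].
    + intros [_ V]. apply Nv. apply (V t). simpl; lia.
Qed.

Lemma integral_vanish N n : forall u : form n,
  vanish n (fun _ => O) (fun _ => N) u -> integral N n u = false.
Proof.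
  induction n as [|n IH]; simpl; intros u H; [exact H|].
  apply xsum_false. intros t Ht. apply IH. apply H; lia.
Qed.

Definition upd (x : nat -> nat) (i c j : nat) : nat := if Nat.eqb j i then c else x j.

(** In the first coordinate the sum telescopes and leaves the two faces t = 0 and t = N, where the
    form vanishes. What remains is the integral of a differential on each slice, which is zero by
    induction. *)
Lemma stokes N n : forall u : form n,
  (forall i c, (i < n)%nat -> c = O \/ c = N ->
     vanish n (upd (fun _ => O) i c) (upd (fun _ => N) i c) u) ->
  integral N n (fdiff u) = false.
Proof.
  induction n as [|n IH]; intros u H; [reflexivity|].
  cbn [fdiff integral snd].
  replace (fun t => integral N n (fadd (fdiff (snd u t)) (fadd (fst u (S t)) (fst u t))))
    with (fun t => xorb (integral N n (fdiff (snd u t)))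
             (xorb (integral N n (fst u (S t))) (integral N n (fst u t))))
    by (extensionality t; rewrite !integral_add; reflexivity).
  rewrite xsum_add, (xsum_telescope N (fun t => integral N n (fst u t))).
  rewrite xsum_false.
  - rewrite !integral_vanish; [reflexivity| |].
    + apply (H O O); unfold upd; simpl; [lia|auto|lia].
    + apply (H O N); unfold upd; simpl; [lia|auto|lia].
  - intros t Ht. apply IH. intros i c Hi Hc.
    apply (H (S i) c); [lia|exact Hc|]. unfold upd; simpl; lia.
Qed.

(** * Forms built from 0/1 labels and the Sperner lemma *)

(** A label as a form of degree 0; it is read at points whose coordinates of index at least [n] are
    0. *)
Fixpoint embed (n : nat) (l : (nat -> nat) -> bool) : form n :=
  match n with
  | O => l (fun _ => O)
  | S m => (fun t => embed m (fun x => l (scons t x)), fun _ => fzero m)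
  end.

Lemma vanish_zero n : forall lo hi, vanish n lo hi (fzero n).
Proof. induction n as [|n IH]; simpl; auto. Qed.

Lemma vanish_embed n : forall lo hi l,
  (forall x, (forall i, (i < n)%nat -> (lo i <= x i <= hi i)%nat) -> l x = false) ->
  vanish n lo hi (embed n l).
Proof.
  induction n as [|n IH]; simpl; intros lo hi l H.
  - apply H; lia.
  - split; intros t Ht; [|apply vanish_zero].
    apply IH. intros x Hx. apply H. intros [|i] Hi; simpl; [exact Ht|].
    apply (Hx i); lia.
Qed.

Lemma embed_negb n : forall l, embed n (fun x => negb (l x)) = fadd (fone n) (embed n l).
Proof.
  induction n as [|n IH]; simpl; intros l; [reflexivity|].
  f_equal; extensionality t; [apply IH|]. symmetry; apply fadd_diag.
Qed.

(** The differential of a constant is zero. The constant [true] is reduced to the constant [false]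
    by d(1 + l) = dl. *)
Lemma vanish_fdiff_embed n lo hi l b :
  (forall x, (forall i, (i < n)%nat -> (lo i <= x i <= hi i)%nat) -> l x = b) ->
  vanish n lo hi (fdiff (embed n l)).
Proof.
  intros H. destruct b.
  - rewrite <- (fadd_0_l n (fdiff _)), <- (fdiff_one n), <- fdiff_add, <- embed_negb.
    apply vanish_fdiff, vanish_embed. intros x Hx. rewrite H; auto.
  - apply vanish_fdiff, vanish_embed, H.
Qed.

(** Nonvanishing of this product on a cell certifies that each of its labels takes both values on
    the vertices of the cell. *)
Fixpoint wedge (n k : nat) (L : nat -> (nat -> nat) -> bool) : form n :=
  match k with
  | O => fone n
  | S k' => fmul (fdiff (embed n (L O))) (wedge n k' (fun i => L (S i)))
  end.

Lemma fdiff_wedge n k : forall L, fdiff (wedge n k L) = fzero n.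
Proof.
  induction k as [|k IH]; simpl; intros L; [apply fdiff_one|].
  rewrite fdiff_mul, fdiff_fdiff, IH, fmul_0_l, fmul_0_r. apply fadd_diag.
Qed.

(** Restriction to the slice x_0 = t commutes with products and with differentials; this is what
    makes induction on the dimension possible. *)
Lemma wedge_slice m k t : forall L,
  fst (wedge (S m) k L) t = wedge m k (fun i x => L i (scons t x)).
Proof.
  induction k as [|k IH]; simpl; intros L; [reflexivity|]. f_equal. apply IH.
Qed.

Lemma vanish_wedge n lo hi i b k : forall L, (i < k)%nat ->
  (forall x, (forall j, (j < n)%nat -> (lo j <= x j <= hi j)%nat) -> L i x = b) ->
  vanish n lo hi (wedge n k L).
Proof.
  revert i; induction k as [|k IH]; simpl; intros i L Hi H; [lia|].
  destruct i as [|i].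
  - apply vanish_mul_l, (vanish_fdiff_embed n lo hi (L O) b H).
  - apply vanish_mul_r. apply (IH i); [lia|exact H].
Qed.

(** The form L_0 W with W = dL_1 ... dL_n need not vanish on the face x_0 = N, so [stokes] does not
    apply to it directly. The first coordinate is telescoped by hand, and [stokes] is used on the
    slices only. *)
Lemma integral_wedge N n : forall L : nat -> (nat -> nat) -> bool,
  (forall i x, (i < n)%nat -> (forall j, (j < n)%nat -> (x j <= N)%nat) ->
     x i = O -> L i x = false) ->
  (forall i x, (i < n)%nat -> (forall j, (j < n)%nat -> (x j <= N)%nat) ->
     x i = N -> L i x = true) ->
  integral N n (wedge n n L) = true.
Proof.
  induction n as [|n IH]; intros L H0 H1; [reflexivity|].
  set (W := wedge (S n) n (fun i => L (S i))).
  set (c := fun t => embed n (fun x => L O (scons t x))).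
  (* W is closed, so the Leibniz rule makes dL_0 W exact. *)
  assert (E : wedge (S n) (S n) L = fdiff (fmul (embed (S n) (L O)) W)).
  { cbn [wedge]. fold W. rewrite fdiff_mul. unfold W at 3.
    rewrite fdiff_wedge, fmul_0_r, fadd_0_r. reflexivity. }
  rewrite E. clear E.
  cbn [fmul embed fst snd fdiff integral]. fold c.
  replace (fun t => integral N n _) with
    (fun t => xorb (integral N n (fdiff (fmul (c t) (snd W t))))
      (xorb (integral N n (fmul (c (S t)) (fst W (S t)))) (integral N n (fmul (c t) (fst W t)))))
    by (extensionality t; rewrite !integral_add, fmul_0_l, fadd_0_r; reflexivity).
  rewrite xsum_add, (xsum_telescope N (fun t => integral N n (fmul (c t) (fst W t)))).
  rewrite xsum_false.
  - rewrite (integral_vanish N n (fmul (c O) (fst W O))).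
    + assert (E : integral N n (fst W N) = true).
      { unfold W. rewrite wedge_slice. apply IH.
        - intros i x Hi Hx Ex. apply H0; [lia| |exact Ex].
          intros [|j] Hj; simpl; [lia|apply Hx; lia].
        - intros i x Hi Hx Ex. apply H1; [lia| |exact Ex].
          intros [|j] Hj; simpl; [lia|apply Hx; lia]. }
      (* On the face x_0 = N the label L_0 is 1, so 1 + L_0 vanishes there and L_0 W has the same
         integral as W, which is 1 by induction. *)
      assert (V : integral N n (fmul (fadd (fone n) (c N)) (fst W N)) = false).
      { apply integral_vanish, vanish_mul_l. unfold c.
        rewrite <- embed_negb. apply vanish_embed. intros x Hx.
        rewrite H1; [reflexivity|lia| |reflexivity].
        intros [|j] Hj; simpl; [lia|]. apply Hx; lia. }
      rewrite fmul_add_l, fmul_1_l, integral_add, E in V.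
      destruct (integral N n (fmul (c N) (fst W N))); [reflexivity|discriminate].
    + apply vanish_mul_l, vanish_embed. intros x Hx. apply H0; [lia| |reflexivity].
      intros [|j] Hj; simpl; [lia|]. apply Hx; lia.
  (* On a face x_(i+1) = d the label L_(i+1) is constant, so the factor dL_(i+1) of W vanishes
     there. *)
  - intros t Ht. apply stokes. intros i d Hi Hd. apply vanish_mul_r.
    assert (V : vanish (S n) (upd (fun _ => O) (S i) d) (upd (fun _ => N) (S i) d) W).
    { apply (vanish_wedge _ _ _ i (if Nat.eqb d O then false else true)); [exact Hi|].
      intros x Hx.
      assert (B : forall j, (j < S n)%nat -> (x j <= N)%nat).
      { intros j Hj. generalize (Hx j Hj). unfold upd.
        destruct (Nat.eqb j (S i)); lia. }
      assert (Exi : x (S i) = d).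
      { assert (G := Hx (S i)). unfold upd in G. rewrite Nat.eqb_refl in G. lia. }
      destruct (Nat.eqb_spec d O) as [->|Hd0].
      - apply H0; [lia|exact B|exact Exi].
      - apply H1; [lia|exact B|lia]. }
    apply V. unfold upd; simpl; lia.
Qed.

(** The integral is 1, so the product of the differentials is nonzero on some cell; a label constant
    on the vertices of that cell would make it vanish. *)
Lemma cubical_sperner N n (L : nat -> (nat -> nat) -> bool) :
  (forall i x, (i < n)%nat -> (forall j, (j < n)%nat -> (x j <= N)%nat) ->
     x i = O -> L i x = false) ->
  (forall i x, (i < n)%nat -> (forall j, (j < n)%nat -> (x j <= N)%nat) ->
     x i = N -> L i x = true) ->
  exists v, (forall j, (j < n)%nat -> (v j < N)%nat) /\
    forall i b, (i < n)%nat -> exists x,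
      (forall j, (j < n)%nat -> (v j <= x j <= S (v j))%nat) /\ L i x = b.
Proof.
  intros H0 H1.
  destruct (integral_true N n _ (integral_wedge N n L H0 H1)) as [v [Hv Nv]].
  exists v; split; [exact Hv|]. intros i b Hi. apply NNPP. intros C. apply Nv.
  apply (vanish_wedge _ _ _ i (negb b)); [exact Hi|]. intros x Hx.
  destruct (Bool.bool_dec (L i x) b) as [E|E].
  - destruct C. exists x; auto.
  - destruct (L i x), b; auto; congruence.
Qed.

(** * Limits along an ultrafilter *)

(** Replaces the extraction of subsequences: a single ultrafilter gives a limit to all bounded
    sequences at once, in particular to the polygons at every time of [0,T]. *)
Definition free_ultrafilter (U : (nat -> Prop) -> Prop) : Prop :=
  ProperFilter U /\ (forall A, U A \/ U (fun n => ~ A n)) /\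
  (forall N, U (fun n => (N <= n)%nat)).

(** An ultrafilter refining the filter of eventual properties, repackaged from the mathcomp filter
    structure into that of Coquelicot. *)
Lemma free_ultrafilter_ex : exists U, free_ultrafilter U.
Proof.
  destruct (filter.ultraFilterLemma filter.eventually_filter) as [U [HU HE]].
  assert (HP : filter.ProperFilter U) by exact (@filter.ultra_proper _ _ HU).
  assert (HF := @filter.filter_filter _ _ HP).
  exists U. split; [|split].
  - constructor.
    + intros P HPU. exact (@filter.filter_ex _ _ HP P HPU).
    + constructor.
      * exact (@filter.filterT _ _ HF).
      * intros P Q. exact (@filter.filterI _ _ HF P Q).
      * intros P Q HPQ. exact (@filter.filterS _ _ HF P Q HPQ).
  - intros A. exact (filter.in_ultra_setVsetC A HU).
  - intros N. apply HE. exists N; [exact I|].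
    intros n Hn. exact (ssrbool.elimT ssrnat.leP Hn).
Qed.

(** The limit is the supremum of the [y] with [y <= u n] for [U]-almost all [n]; the upper estimate
    uses that [U] contains each set or its complement. *)
Lemma ultrafilter_lim (U : (nat -> Prop) -> Prop) (u : nat -> R) (B : R) :
  free_ultrafilter U -> (forall n, Rabs (u n) <= B) ->
  exists l, Rabs l <= B /\ filterlim u U (locally l).
Proof.
  intros [HP [HU HN]] HB.
  assert (HB' : forall n, - B <= u n <= B) by (intros n; apply Rabs_le_between, HB).
  destruct (completeness (fun y => U (fun n => y <= u n))) as [l [Hub Hlub]].
  { exists B. intros y Hy. destruct (filter_ex _ Hy) as [n Hn]. generalize (HB' n); lra. }
  { exists (- B). apply filter_forall. intros n; apply HB'. }
  assert (Hl : - B <= l <= B).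
  { split.
    - apply Hub. apply filter_forall. intros n; apply HB'.
    - apply Hlub. intros y Hy. destruct (filter_ex _ Hy) as [n Hn].
      generalize (HB' n); lra. }
  exists l. split; [apply Rabs_le_between, Hl|].
  apply filterlim_locally. intros e.
  assert (H1 : U (fun n => l - e < u n)).
  { apply NNPP. intros C.
    assert (l <= l - e); [|generalize (cond_pos e); lra].
    apply Hlub. intros y Hy. destruct (Rle_dec y (l - e)) as [|Hn]; [assumption|].
    destruct C. revert Hy. apply filter_imp. intros n; lra. }
  assert (H2 : U (fun n => u n < l + e)).
  { destruct (HU (fun n => l + e <= u n)) as [H|H].
    - assert (l + e <= l) by (apply Hub, H). generalize (cond_pos e); lra.
    - revert H. apply filter_imp. intros n; lra. }
  generalize (filter_and _ _ H1 H2). apply filter_imp. intros n Hn.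
  apply Rabs_lt_between. unfold minus, plus, opp; simpl. lra.
Qed.

(** * Approximate Poincare-Miranda theorem and Euler polygons *)

Definition coord_close (n : nat) (d : R) (x y : nat -> R) : Prop :=
  forall j, (j < n)%nat -> Rabs (x j - y j) < d.

Definition in_cube (n : nat) (M : R) (x : nat -> R) : Prop :=
  forall j, (j < n)%nat -> Rabs (x j) <= M.

(** The vertices of a fine grid are labelled by the signs of the components of [F]. In a Sperner
    cell every component takes both signs, so by uniform continuity it is smaller than [e] at a
    corner. *)
Lemma poincare_miranda_approx (n : nat) (M : R) (F : (nat -> R) -> nat -> R) :
  0 < M ->
  (forall e, 0 < e -> exists d, 0 < d /\ forall x y, coord_close n d x y -> coord_close n e (F x) (F y)) ->
  (forall x i, (i < n)%nat -> in_cube n M x -> x i = M -> 0 <= F x i) ->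
  (forall x i, (i < n)%nat -> in_cube n M x -> x i = - M -> F x i <= 0) ->
  forall e, 0 < e -> exists x, in_cube n M x /\ forall i, (i < n)%nat -> Rabs (F x i) < e.
Proof.
  intros HM HF Hpos Hneg e He.
  destruct (HF e He) as [d [Hd Hclose]].
  destruct (nfloor_ex (2 * M / d)) as [N0 [_ HN0]].
  { apply Rlt_le, Rdiv_lt_0_compat; lra. }
  set (N := S N0).
  assert (HN : 2 * M / INR N < d).
  { unfold N. rewrite S_INR. apply Rlt_div_l; [generalize (pos_INR N0); lra|].
    apply Rlt_div_l in HN0; lra. }
  assert (PN : 0 < INR N) by (apply lt_0_INR; unfold N; lia).
  set (pt := fun (v : nat -> nat) j => - M + 2 * M / INR N * INR (v j)).
  assert (Hcube : forall v, (forall j, (j < n)%nat -> (v j <= N)%nat) -> in_cube n M (pt v)).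
  { intros v Hv j Hj. apply Rabs_le_between. unfold pt.
    assert (H1 := pos_INR (v j)). assert (H2 := le_INR _ _ (Hv j Hj)).
    assert (0 <= 2 * M / INR N * INR (v j) <= 2 * M); [|lra]. split.
    - apply Rmult_le_pos; [|lra]. apply Rlt_le, Rdiv_lt_0_compat; lra.
    - replace (2 * M) with (2 * M / INR N * INR N) at 2 by (field; lra).
      apply Rmult_le_compat_l; [|lra]. apply Rlt_le, Rdiv_lt_0_compat; lra. }
  (* On the faces the sign conditions are weak and [F] may vanish, so the labels there are
     prescribed; they still agree with the weak signs of [F]. *)
  set (L := fun i (v : nat -> nat) =>
    if Nat.eqb (v i) 0 then false else if Nat.eqb (v i) N then true
    else if Rlt_dec 0 (F (pt v) i) then true else false).
  destruct (cubical_sperner N n L) as [v [Hv HL]].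
  { intros i x _ _ E. unfold L. rewrite E. reflexivity. }
  { intros i x _ _ E. unfold L. rewrite E, (Nat.eqb_refl N). reflexivity. }
  exists (pt v). split; [apply Hcube; intros j Hj; generalize (Hv j Hj); lia|].
  intros i Hi.
  assert (Hcell : forall y, (forall j, (j < n)%nat -> (v j <= y j <= S (v j))%nat) ->
            in_cube n M (pt y) /\ Rabs (F (pt v) i - F (pt y) i) < e).
  { intros y Hy. split.
    - apply Hcube. intros j Hj. generalize (Hv j Hj) (Hy j Hj); lia.
    - apply Hclose; [|exact Hi]. intros j Hj. unfold pt.
      replace (- M + 2 * M / INR N * INR (v j) - (- M + 2 * M / INR N * INR (y j)))
        with (- (2 * M / INR N * (INR (y j) - INR (v j)))) by ring.
      assert (Q : 0 < 2 * M / INR N) by (apply Rdiv_lt_0_compat; lra).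
      rewrite Rabs_Ropp, Rabs_mult, (Rabs_pos_eq _ (Rlt_le _ _ Q)).
      assert (Hyj := Hy j Hj).
      assert (A1 := le_INR _ _ (proj1 Hyj)). assert (A2 := le_INR _ _ (proj2 Hyj)).
      rewrite S_INR in A2. rewrite Rabs_pos_eq by lra. nra. }
  destruct (HL i true Hi) as [y1 [Hy1 E1]]. destruct (HL i false Hi) as [y0 [Hy0 E0]].
  destruct (Hcell y1 Hy1) as [C1 D1]. destruct (Hcell y0 Hy0) as [C0 D0].
  apply Rabs_lt_between in D1. apply Rabs_lt_between in D0.
  assert (F1 : 0 <= F (pt y1) i).
  { unfold L in E1. destruct (Nat.eqb (y1 i) 0); [discriminate|].
    destruct (Nat.eqb_spec (y1 i) N) as [E|].
    - apply Hpos; auto. unfold pt. rewrite E. field; lra.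
    - destruct (Rlt_dec 0 (F (pt y1) i)); [lra|discriminate]. }
  assert (F0 : F (pt y0) i <= 0).
  { unfold L in E0. destruct (Nat.eqb_spec (y0 i) 0) as [E|].
    - apply Hneg; auto. unfold pt. rewrite E. simpl. ring.
    - destruct (Nat.eqb (y0 i) N); [discriminate|].
      destruct (Rlt_dec 0 (F (pt y0) i)); [discriminate|lra]. }
  apply Rabs_lt_between. lra.
Qed.

(** * Euler polygons for bounded perturbations of a hyperbolic linear system *)

(** Nodes of the explicit Euler scheme with step [h] for x_i' = s_i x_i + P_i(t, x), started from
    [x] at time 0. *)
Fixpoint euler (s : nat -> R) (P : nat -> R -> (nat -> R) -> R) (h : R) (x : nat -> R)
    (k : nat) : nat -> R :=
  match k with
  | O => x
  | S k' => fun i => let y := euler s P h x k' in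
      y i + h * (s i * y i + P i (INR k' * h) y)
  end.

(** The bound [M] on [P] will also be the half-width of the cube of initial values. Continuity of
    [P] is required uniformly because the state ranges over a non-compact space. *)
Definition bounded_perturbation (n : nat) (T M : R) (s : nat -> R)
    (P : nat -> R -> (nat -> R) -> R) : Prop :=
  (forall i, (i < n)%nat -> s i = 1 \/ s i = - 1) /\
  (forall i t x, (i < n)%nat -> Icc T t -> Rabs (P i t x) <= M) /\
  (forall e, 0 < e -> exists d, 0 < d /\ forall t t' x y, Icc T t -> Icc T t' ->
     Rabs (t - t') < d -> coord_close n d x y -> coord_close n e (fun i => P i t x) (fun i => P i t' y)).

Lemma euler_uniformly_continuous n T M s P h k :
  bounded_perturbation n T M s P -> 0 < h <= 1 -> INR k * h <= T ->
  forall e, 0 < e -> exists d, 0 < d /\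
    forall x y, coord_close n d x y -> coord_close n e (euler s P h x k) (euler s P h y k).
Proof.
  intros [Hs [HP HU]] Hh. induction k as [|k IH]; intros Hk e He.
  { exists e; split; auto. }
  rewrite S_INR in Hk.
  assert (HI : Icc T (INR k * h)).
  { split; [|lra]. apply Rmult_le_pos; [apply pos_INR|lra]. }
  destruct (HU (e / 2)) as [d1 [Hd1 H1]]; [lra|].
  (* Since h <= 1, one step turns an error below e/4 into one below (1 + h) e/4 + h e/2 <= e. *)
  destruct (IH ltac:(lra) (Rmin (e / 4) d1)) as [d [Hd H2]]; [apply Rmin_pos; lra|].
  exists d; split; [exact Hd|]. intros x y Hxy i Hi. simpl.
  set (u := euler s P h x k). set (v := euler s P h y k).
  assert (C : coord_close n (Rmin (e / 4) d1) u v) by apply H2, Hxy.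
  assert (C1 : coord_close n d1 u v).
  { intros j Hj. eapply Rlt_le_trans; [apply C, Hj|apply Rmin_r]. }
  assert (C2 : Rabs (u i - v i) < e / 4).
  { eapply Rlt_le_trans; [apply C, Hi|apply Rmin_l]. }
  assert (C3 : Rabs (P i (INR k * h) u - P i (INR k * h) v) < e / 2).
  { apply (H1 (INR k * h) (INR k * h)); auto. rewrite Rminus_diag, Rabs_R0; exact Hd1. }
  apply Rabs_lt_between in C2. apply Rabs_lt_between in C3.
  set (p := P i (INR k * h) u) in *. set (q := P i (INR k * h) v) in *.
  apply Rabs_lt_between.
  replace (u i + h * (s i * u i + p) - (v i + h * (s i * v i + q)))
    with ((u i - v i) + h * (s i * (u i - v i) + (p - q))) by ring.
  destruct (Hs i Hi) as [-> | ->]; split; nra.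
Qed.

(** Discrete Gronwall estimate: |y_i| + M starts at no more than 2M and grows at each step by a
    factor at most 1 + h <= exp h. *)
Lemma euler_bound n T M s P h x k :
  0 < M -> bounded_perturbation n T M s P -> 0 < h -> INR k * h <= T ->
  in_cube n M x -> in_cube n (2 * M * exp (INR k * h) - M) (euler s P h x k).
Proof.
  intros HM [Hs [HP HU]] Hh. induction k as [|k IH]; intros Hk Hx i Hi.
  - simpl. rewrite Rmult_0_l, exp_0. generalize (Hx i Hi); lra.
  - rewrite S_INR in Hk.
    assert (HI : Icc T (INR k * h)).
    { split; [|lra]. apply Rmult_le_pos; [apply pos_INR|lra]. }
    assert (HY := IH ltac:(lra) Hx i Hi). cbn [euler].
    set (u := euler s P h x k) in *.
    assert (HPu := HP i (INR k * h) u Hi HI).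
    apply Rabs_le_between in HY. apply Rabs_le_between in HPu.
    rewrite S_INR, Rmult_plus_distr_r, Rmult_1_l, exp_plus.
    assert (E := exp_ineq1_le h). assert (E0 := exp_pos (INR k * h)).
    set (E1 := exp (INR k * h)) in *. set (p := P i (INR k * h) u) in *.
    assert (M * E1 * (1 + h) <= M * E1 * exp h) by (apply Rmult_le_compat_l; nra).
    apply Rabs_le_between. destruct (Hs i Hi) as [-> | ->]; split; nra.
Qed.

(** If s_i = 1, a coordinate starting at M or -M is never pushed back inwards. If s_i = -1 and h <=
    1, the interval [-M, M] is invariant. The factor s_i gives both cases the signs required by the
    Poincare-Miranda theorem. *)
Lemma euler_face n T M s P h x k i :
  0 < M -> bounded_perturbation n T M s P -> 0 < h <= 1 -> INR k * h <= T ->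
  (i < n)%nat -> in_cube n M x ->
  (x i = M -> 0 <= s i * (euler s P h x k i - x i)) /\
  (x i = - M -> s i * (euler s P h x k i - x i) <= 0).
Proof.
  intros HM [Hs [HP HU]] Hh Hk Hi Hx.
  assert (Step : forall j, (j < k)%nat -> Rabs (P i (INR j * h) (euler s P h x j)) <= M).
  { intros j Hj. apply HP; [exact Hi|]. split.
    - apply Rmult_le_pos; [apply pos_INR|lra].
    - apply Rle_trans with (2 := Hk). apply Rmult_le_compat_r; [lra|].
      apply le_INR; lia. }
  destruct (Hs i Hi) as [E|E]; rewrite E.
  - split; intros Ex; rewrite Ex.
    + assert (M <= euler s P h x k i); [|lra].
      clear Hk. induction k as [|k IH]; [simpl; lra|].
      assert (G := IH ltac:(intros; apply Step; lia)).
      assert (S := Step k ltac:(lia)). apply Rabs_le_between in S.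
      cbn [euler]. rewrite E. nra.
    + assert (euler s P h x k i <= - M); [|lra].
      clear Hk. induction k as [|k IH]; [simpl; lra|].
      assert (G := IH ltac:(intros; apply Step; lia)).
      assert (S := Step k ltac:(lia)). apply Rabs_le_between in S.
      cbn [euler]. rewrite E. nra.
  - assert (G : - M <= euler s P h x k i <= M); [|split; intros ->; lra].
    clear Hk. induction k as [|k IH].
    + simpl. apply Rabs_le_between, Hx, Hi.
    + assert (G := IH ltac:(intros; apply Step; lia)).
      assert (S := Step k ltac:(lia)). apply Rabs_le_between in S.
      cbn [euler]. rewrite E. split; nra.
Qed.

(** The Poincare-Miranda theorem is applied to s_i (y_i(T) - x_i); the condition [T <= INR K] keeps
    the step at most 1. *)
Lemma euler_periodic_approx n T M s P K e :
  0 < M -> bounded_perturbation n T M s P -> 0 < T -> T <= INR K -> 0 < e ->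
  exists x, in_cube n M x /\
    forall i, (i < n)%nat -> Rabs (euler s P (T / INR K) x K i - x i) < e.
Proof.
  intros HM HP HT HK He.
  assert (Hh : 0 < T / INR K <= 1).
  { split; [apply Rdiv_lt_0_compat; lra|]. apply Rle_div_l; lra. }
  assert (HkT : INR K * (T / INR K) = T) by (field; lra).
  set (h := T / INR K) in *.
  destruct (poincare_miranda_approx n M
    (fun x i => s i * (euler s P h x K i - x i)) HM) with (e := e) as [x [Hx Hz]]; auto.
  - intros d Hd.
    destruct (euler_uniformly_continuous n T M s P h K HP Hh ltac:(lra) (d / 2))
      as [d' [Hd' Hc]]; [lra|].
    exists (Rmin d' (d / 2)). split; [apply Rmin_pos; lra|].
    intros x y Hxy i Hi.
    assert (C := Hc x y). assert (A : coord_close n d' x y).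
    { intros j Hj. eapply Rlt_le_trans; [apply Hxy, Hj|apply Rmin_l]. }
    specialize (C A i Hi).
    assert (D : Rabs (x i - y i) < d / 2).
    { eapply Rlt_le_trans; [apply Hxy, Hi|apply Rmin_r]. }
    apply Rabs_lt_between in C. apply Rabs_lt_between in D. apply Rabs_lt_between.
    destruct HP as [Hs _]. destruct (Hs i Hi) as [-> | ->]; lra.
  - intros x i Hi Hx. apply (euler_face n T M); auto; lra.
  - intros x i Hi Hx. apply (euler_face n T M); auto; lra.
  - exists x. split; [exact Hx|]. intros i Hi. specialize (Hz i Hi). cbv beta in Hz.
    destruct HP as [Hs _]. rewrite Rabs_mult in Hz.
    destruct (Hs i Hi) as [E|E]; rewrite E in Hz;
      [rewrite Rabs_R1 in Hz | rewrite Rabs_m1 in Hz]; lra.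
Qed.

(** * Difference quotients of the polygons and their limit *)

(** A discrete mean value inequality. Taking [c] = 0 yields the Lipschitz bound, and taking for [c]
    the slope at a given time yields the approximate derivative. *)
Lemma euler_increment s P h x i c e j : forall m,
  0 <= h -> (j <= m)%nat ->
  (forall k, (j <= k < m)%nat ->
     Rabs (s i * euler s P h x k i + P i (INR k * h) (euler s P h x k) - c) <= e) ->
  Rabs (euler s P h x m i - euler s P h x j i - (INR m - INR j) * h * c)
    <= (INR m - INR j) * h * e.
Proof.
  induction m as [|m IH]; intros Hh Hjm H.
  - replace j with O by lia. rewrite !Rminus_diag, !Rmult_0_l, Rminus_0_r, Rabs_R0. lra.
  - destruct (Nat.eq_dec j (S m)) as [->|Hne].
    + rewrite !Rminus_diag, !Rmult_0_l, Rminus_0_r, Rabs_R0. lra.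
    + assert (A := IH Hh ltac:(lia) ltac:(intros; apply H; lia)).
      assert (B := H m ltac:(lia)).
      apply Rabs_le_between in A. apply Rabs_le_between in B.
      rewrite S_INR. cbn [euler].
      set (g := s i * euler s P h x m i + P i (INR m * h) (euler s P h x m)) in *.
      apply Rabs_le_between. split; nra.
Qed.

(** A form without division in which [r = t] is allowed. *)
Lemma is_derive_Icc_eps T u t l :
  is_derive_Icc T u t l <->
  forall e, 0 < e -> exists d, 0 < d /\ forall r, Icc T r -> Rabs (r - t) < d ->
    Rabs (u r - u t - l * (r - t)) <= e * Rabs (r - t).
Proof.
  unfold is_derive_Icc, D_in, limit1_in, limit_in, D_x. simpl. unfold Rdist. split.
  - intros H e He. destruct (H e He) as [d [Hd Hl]]. exists d; split; [exact Hd|].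
    intros r Hr Hrt. destruct (Req_dec r t) as [->|Hne].
    + rewrite !Rminus_diag, Rmult_0_r, Rminus_0_r, Rabs_R0. lra.
    + specialize (Hl r (conj (conj Hr (not_eq_sym Hne)) Hrt)).
      replace (u r - u t - l * (r - t)) with (((u r - u t) / (r - t) - l) * (r - t))
        by (field; lra).
      rewrite Rabs_mult. apply Rmult_le_compat_r; [apply Rabs_pos|lra].
  - intros H e He. destruct (H (e / 2) ltac:(lra)) as [d [Hd Hl]].
    exists d; split; [exact Hd|]. intros r [[Hr Hne] Hrt].
    specialize (Hl r Hr Hrt).
    assert (P : 0 < Rabs (r - t)) by (apply Rabs_pos_lt; lra).
    replace ((u r - u t) / (r - t) - l) with ((u r - u t - l * (r - t)) / (r - t))
      by (field; lra).
    unfold Rdiv. rewrite Rabs_mult, Rabs_inv.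
    apply Rle_lt_trans with (e / 2); [|lra].
    apply Rle_div_l; lra.
Qed.

Definition floor_nat (x : R) : nat := Z.to_nat (Int_part x).

Lemma floor_nat_spec x : 0 <= x -> INR (floor_nat x) <= x < INR (floor_nat x) + 1.
Proof.
  intros Hx. destruct (base_Int_part x) as [H1 H2]. unfold floor_nat.
  assert (0 <= Int_part x)%Z.
  { assert (-1 < Int_part x)%Z; [|lia]. apply lt_IZR. lra. }
  rewrite INR_IZR_INZ, Z2Nat.id by assumption. lra.
Qed.

Lemma floor_nat_INR k : floor_nat (INR k) = k.
Proof.
  destruct (floor_nat_spec (INR k) (pos_INR k)) as [H1 H2].
  apply INR_le in H1. rewrite <- S_INR in H2. apply INR_lt in H2. lia.
Qed.

(** The polygon is bounded by 2M exp T - M and the perturbation adds at most M, whence the bound 2M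
    exp T on the slopes. *)
Lemma euler_lipschitz n T M s P h x i j m :
  0 < M -> bounded_perturbation n T M s P -> 0 < h -> INR m * h <= T ->
  in_cube n M x -> (i < n)%nat -> (j <= m)%nat ->
  Rabs (euler s P h x m i - euler s P h x j i) <= (INR m - INR j) * h * (2 * M * exp T) /\
  forall k, (k <= m)%nat ->
  Rabs (s i * euler s P h x k i + P i (INR k * h) (euler s P h x k)) <= 2 * M * exp T.
Proof.
  intros HM HP Hh Hm Hx Hi Hjm.
  assert (A : forall k, (k <= m)%nat ->
    Rabs (s i * euler s P h x k i + P i (INR k * h) (euler s P h x k)) <= 2 * M * exp T).
  { intros k Hk.
    assert (Hkh : 0 <= INR k * h <= T).
    { split; [apply Rmult_le_pos; [apply pos_INR|lra]|].
      apply Rle_trans with (2 := Hm). apply Rmult_le_compat_r; [lra|].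
      apply le_INR; lia. }
    assert (B := euler_bound n T M s P h x k HM HP Hh (proj2 Hkh) Hx i Hi).
    destruct HP as [Hs [HP _]].
    assert (C := HP i (INR k * h) (euler s P h x k) Hi Hkh).
    assert (E : exp (INR k * h) <= exp T).
    { destruct (Req_dec (INR k * h) T) as [->|]; [lra|].
      apply Rlt_le, exp_increasing; lra. }
    apply Rabs_le_between in B. apply Rabs_le_between in C. apply Rabs_le_between.
    destruct (Hs i Hi) as [-> | ->]; split; nra. }
  split; [|exact A].
  replace (euler s P h x m i - euler s P h x j i) with
    (euler s P h x m i - euler s P h x j i - (INR m - INR j) * h * 0) by ring.
  apply euler_increment; [lra|exact Hjm|].
  intros k Hk. rewrite Rminus_0_r. apply A. lia.
Qed.

(** The order of quantifiers is the point: [d] depends on [e] alone, while [h0] may depend on [t]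
    and [r]. With [t] and [r] fixed the step can tend to 0, and the limit inherits the estimate with
    the same [d]. The indices [j] and [l] are the nodes just below [t] and [r]. *)
Lemma euler_derivative_approx n T M s P e :
  0 < M -> bounded_perturbation n T M s P -> 0 < e ->
  exists d, 0 < d /\ forall t r, Icc T t -> Icc T r -> 0 < Rabs (r - t) < d ->
  exists h0, 0 < h0 /\ forall h x j l i, 0 < h < h0 -> in_cube n M x ->
    INR j * h <= t < (INR j + 1) * h -> INR l * h <= r < (INR l + 1) * h -> (i < n)%nat ->
    Rabs (euler s P h x l i - euler s P h x j i
          - (s i * euler s P h x j i + P i t (euler s P h x j)) * (r - t)) <= e * Rabs (r - t).
Proof.
  intros HM HP He.
  set (C := 2 * M * exp T).
  assert (HC : 0 < C) by (unfold C; generalize (exp_pos T); nra).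
  destruct HP as [Hs [HPb HU]] eqn:EP.
  destruct (HU (e / 8) ltac:(lra)) as [d1 [Hd1 HU1]].
  set (q := Rmin d1 (e / 8)).
  assert (Hq : 0 < q) by (apply Rmin_pos; lra).
  assert (Hq1 : q <= d1) by apply Rmin_l. assert (Hq2 : q <= e / 8) by apply Rmin_r.
  (* With D = |r - t| and h < D, the nodes involved are within D + h < 2D of t and the states there
     differ by at most 2DC; both quantities are below q. *)
  exists (q / (2 * (C + 1))). split; [apply Rdiv_lt_0_compat; lra|].
  intros t r Ht Hr [Hrt0 Hrt].
  set (D := Rabs (r - t)) in *.
  assert (HD : 2 * D * (C + 1) < q).
  { apply Rlt_div_r in Hrt; [|lra]. lra. }
  (* The second bound makes hC, the cost of rounding t and r down to nodes, at most eD/2. The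
     variation of the slope costs at most (D + h) e/4 <= eD/2. *)
  exists (Rmin D (e * D / (2 * C))). split.
  { apply Rmin_pos; [lra|]. apply Rdiv_lt_0_compat; nra. }
  intros h x j l i [Hh0 Hh] Hx Hj Hl Hi.
  assert (HhD : h < D) by (eapply Rlt_le_trans; [exact Hh|apply Rmin_l]).
  assert (HhC : h * C <= e * D / 2).
  { assert (h <= e * D / (2 * C)).
    { apply Rlt_le. eapply Rlt_le_trans; [exact Hh|apply Rmin_r]. }
    replace (e * D / 2) with (e * D / (2 * C) * C) by (field; lra). nra. }
  set (Y := euler s P h x) in *.
  set (c := s i * Y j i + P i t (Y j)).
  assert (HjT : INR j * h <= T) by (unfold Icc in *; lra).
  assert (HlT : INR l * h <= T) by (unfold Icc in *; lra).
  assert (Hc : Rabs c <= C).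
  { assert (B := euler_bound n T M s P h x j HM HP Hh0 HjT Hx i Hi). fold Y in B.
    assert (B2 := HPb i t (Y j) Hi Ht).
    assert (E : exp (INR j * h) <= exp T).
    { destruct (Req_dec (INR j * h) T) as [->|]; [lra|].
      apply Rlt_le, exp_increasing; lra. }
    unfold c, C. apply Rabs_le_between in B. apply Rabs_le_between in B2.
    apply Rabs_le_between. destruct (Hs i Hi) as [-> | ->]; split; nra. }
  assert (Hslope : forall k, (INR k * h <= T) -> Rabs (INR k * h - t) <= D + h ->
     (forall i', (i' < n)%nat -> Rabs (Y k i' - Y j i') <= (D + h) * C) ->
     Rabs (s i * Y k i + P i (INR k * h) (Y k) - c) <= e / 4).
  { intros k Hk Hkt HY.
    assert (A1 : Rabs (P i (INR k * h) (Y k) - P i t (Y j)) < e / 8).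
    { apply (HU1 (INR k * h) t (Y k) (Y j)); auto.
      - split; [apply Rmult_le_pos; [apply pos_INR|lra]|exact Hk].
      - nra.
      - intros i' Hi'. eapply Rle_lt_trans; [apply HY, Hi'|]. nra. }
    assert (A2 : Rabs (Y k i - Y j i) <= e / 8).
    { eapply Rle_trans; [apply HY, Hi|]. nra. }
    unfold c. apply Rabs_lt_between in A1. apply Rabs_le_between in A2.
    apply Rabs_le_between. destruct (Hs i Hi) as [-> | ->]; lra. }
  assert (Main : Rabs (Y l i - Y j i - (INR l - INR j) * h * c) <= (D + h) * (e / 4)).
  { destruct (Rle_lt_dec t r) as [Htr|Htr].
    - assert (ED : D = r - t) by (apply Rabs_pos_eq; lra).
      assert (Hjl : (j <= l)%nat).
      { assert (INR j < INR (S l)); [|apply INR_lt in H; lia].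
        rewrite S_INR. nra. }
      assert (Hlen : (INR l - INR j) * h <= D + h) by nra.
      eapply Rle_trans; [apply (euler_increment s P h x i c (e / 4) j l); [lra|exact Hjl|]|].
      + intros k Hk. apply Hslope.
        * apply Rle_trans with (2 := HlT). apply Rmult_le_compat_r; [lra|apply le_INR; lia].
        * assert (K1 := le_INR j k ltac:(lia)). assert (K2 := le_INR k l ltac:(lia)).
          apply Rabs_le_between. split; nra.
        * intros i' Hi'.
          assert (K1 := le_INR j k ltac:(lia)). assert (K2 := le_INR k l ltac:(lia)).
          eapply Rle_trans; [apply (euler_lipschitz n T M s P h x i' j k); auto; [nra|lia]|].
          fold C. apply Rmult_le_compat_r; [lra|nra].
      + apply Rmult_le_compat_r; lra.
    - assert (ED : D = t - r) by (unfold D; rewrite Rabs_left; lra).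
      assert (Hjl : (l <= j)%nat).
      { assert (INR l < INR (S j)); [|apply INR_lt in H; lia].
        rewrite S_INR. nra. }
      assert (Hlen : (INR j - INR l) * h <= D + h) by nra.
      replace (Y l i - Y j i - (INR l - INR j) * h * c) with
        (- (Y j i - Y l i - (INR j - INR l) * h * c)) by ring.
      rewrite Rabs_Ropp.
      eapply Rle_trans; [apply (euler_increment s P h x i c (e / 4) l j); [lra|exact Hjl|]|].
      + intros k Hk. apply Hslope.
        * apply Rle_trans with (2 := HjT). apply Rmult_le_compat_r; [lra|apply le_INR; lia].
        * assert (K1 := le_INR l k ltac:(lia)). assert (K2 := le_INR k j ltac:(lia)).
          apply Rabs_le_between. split; nra.
        * intros i' Hi'.
          assert (K1 := le_INR l k ltac:(lia)). assert (K2 := le_INR k j ltac:(lia)).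
          rewrite Rabs_minus_sym.
          eapply Rle_trans; [apply (euler_lipschitz n T M s P h x i' k j); auto; lia|].
          fold C. apply Rmult_le_compat_r; [lra|nra].
      + apply Rmult_le_compat_r; lra. }
  replace (Y l i - Y j i - c * (r - t)) with
    ((Y l i - Y j i - (INR l - INR j) * h * c)
     + ((INR l * h - r) - (INR j * h - t)) * c) by ring.
  eapply Rle_trans; [apply Rabs_triang|]. rewrite Rabs_mult.
  assert (Rabs ((INR l * h - r) - (INR j * h - t)) <= h).
  { apply Rabs_le_between. lra. }
  assert (Rabs (INR l * h - r - (INR j * h - t)) * Rabs c <= h * C).
  { apply Rmult_le_compat; auto using Rabs_pos. }
  nra.
Qed.

Lemma filterlim_eps (U : (nat -> Prop) -> Prop) (u : nat -> R) l e :
  Filter U -> filterlim u U (locally l) -> 0 < e -> U (fun m => Rabs (u m - l) < e).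
Proof.
  intros HU Hl He.
  exact (proj1 (@filterlim_locally nat R_UniformSpace U HU u l) Hl (mkposreal e He)).
Qed.

Lemma filter_coord_close (U : (nat -> Prop) -> Prop) (u : nat -> nat -> R) (l : nat -> R) n e :
  Filter U -> (forall j, (j < n)%nat -> filterlim (fun m => u m j) U (locally (l j))) ->
  0 < e -> U (fun m => coord_close n e (u m) l).
Proof.
  intros HU Hl He. induction n as [|n IH].
  - apply filter_forall. intros m j Hj; lia.
  - assert (A := IH ltac:(auto)).
    assert (B := filterlim_eps U _ _ e HU (Hl n ltac:(lia)) He).
    generalize (filter_and _ _ A B). apply filter_imp. intros m [H1 H2] j Hj.
    destruct (Nat.eq_dec j n) as [->|]; [exact H2|apply H1; lia].
Qed.

Lemma Rabs_le_all_eps x : (forall e, 0 < e -> Rabs x <= e) -> x = 0.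
Proof.
  intros H. destruct (Req_dec x 0) as [|Hx]; [assumption|].
  apply Rabs_pos_lt in Hx. specialize (H (Rabs x / 2)). lra.
Qed.

(** The solution is the pointwise limit along [U] of almost periodic polygons whose steps tend to
    0. *)
Lemma periodic_bounded_perturbation n T M s P :
  0 < T -> 0 < M -> bounded_perturbation n T M s P ->
  exists x : nat -> R -> R, forall i, (i < n)%nat ->
    x i 0 = x i T /\
    forall t, Icc T t ->
      is_derive_Icc T (x i) t (s i * x i t + P i t (fun j => x j t)).
Proof.
  intros HT HM HP.
  destruct (nfloor_ex T (Rlt_le _ _ HT)) as [K0 [_ HK0]].
  set (K := fun m => (S m + K0)%nat).
  assert (HK : forall m, T <= INR (K m) /\ INR m < INR (K m)).
  { intros m. unfold K. rewrite plus_INR, S_INR. generalize (pos_INR m) (pos_INR K0). lra. }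
  set (h := fun m => T / INR (K m)).
  assert (Hh : forall m, 0 < h m).
  { intros m. apply Rdiv_lt_0_compat; [lra|]. destruct (HK m). lra. }
  assert (HKh : forall m, INR (K m) * h m = T).
  { intros m. unfold h. field. destruct (HK m). lra. }
  destruct (functional_choice (fun m x0 => in_cube n M x0 /\ forall i, (i < n)%nat ->
      Rabs (euler s P (h m) x0 (K m) i - x0 i) < / (INR m + 1))) as [x0 Hx0].
  { intros m. apply (euler_periodic_approx n T); auto; [apply HK|].
    apply Rinv_0_lt_compat. generalize (pos_INR m); lra. }
  set (fl := fun m t => floor_nat (t / h m)).
  assert (Hfl : forall m t, Icc T t -> INR (fl m t) * h m <= t < (INR (fl m t) + 1) * h m).
  { intros m t Ht. assert (Hm := Hh m).
    destruct (floor_nat_spec (t / h m)) as [H1 H2].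
    - apply Rdiv_le_0_compat; [apply Ht|exact Hm].
    - fold (fl m t) in H1, H2. split.
      + apply Rle_div_r in H1; auto.
      + apply Rlt_div_l in H2; auto. }
  set (Y := fun m t => euler s P (h m) (x0 m) (fl m t)).
  destruct free_ultrafilter_ex as [U HU].
  assert (HUf : ProperFilter U) by apply HU.
  assert (HFU : Filter U) by apply HUf.
  (* One choice over pairs (coordinate, time) gives all limits together; 0 is the witness outside
     the relevant range. *)
  destruct (functional_choice (fun (a : nat * R) l => (fst a < n)%nat -> Icc T (snd a) ->
      filterlim (fun m => Y m (snd a) (fst a)) U (locally l))) as [x Hx].
  { intros [i t]. simpl. destruct (classic ((i < n)%nat /\ Icc T t)) as [[Hi Ht]|N].
    - destruct (ultrafilter_lim U (fun m => Y m t i) (2 * M * exp T - M) HU) as [l [_ Hl]].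
      + intros m. destruct (Hfl m t Ht) as [F1 F2].
        assert (B := euler_bound n T M s P (h m) (x0 m) (fl m t) HM HP (Hh m)
                       ltac:(unfold Icc in Ht; lra) (proj1 (Hx0 m)) i Hi).
        assert (E : exp (INR (fl m t) * h m) <= exp T).
        { destruct (Req_dec (INR (fl m t) * h m) T) as [->|]; [lra|].
          apply Rlt_le, exp_increasing. unfold Icc in Ht; lra. }
        unfold Y. nra.
      + exists l; auto.
    - exists 0. intros; destruct N; auto. }
  assert (Hsmall : forall e, 0 < e -> U (fun m => h m < e /\ / (INR m + 1) < e)).
  { intros e He. destruct (nfloor_ex ((T + 1) / e)) as [N [_ HN]].
    { apply Rdiv_le_0_compat; lra. }
    apply Rlt_div_l in HN; [|lra].
    destruct HU as [_ [_ HU]]. generalize (HU (S N)). apply filter_imp. intros m Hm.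
    apply le_INR in Hm. rewrite S_INR in Hm. destruct (HK m) as [H1 H2].
    assert (HN0 := pos_INR N). split.
    - unfold h. apply Rlt_div_l; [lra|]. nra.
    - apply Rmult_lt_reg_r with (INR m + 1); [lra|]. rewrite Rinv_l by lra. nra. }
  exists (fun i t => x (i, t)). intros i Hi.
  assert (I0 : Icc T 0) by (unfold Icc; lra). assert (IT : Icc T T) by (unfold Icc; lra).
  split.
  - apply Rminus_diag_uniq, Rabs_le_all_eps. intros e He.
    assert (A0 := filterlim_eps U _ _ (e / 3) HFU (Hx (i, 0) Hi I0) ltac:(lra)).
    assert (A1 := filterlim_eps U _ _ (e / 3) HFU (Hx (i, T) Hi IT) ltac:(lra)).
    assert (A01 := filter_and _ _ A0 A1).
    assert (A := @filter_and _ U HFU _ _ (Hsmall (e / 3) ltac:(lra)) A01).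
    destruct (filter_ex _ A)
      as [m [[_ H0] [H1 H2]]].
    (* The times 0 and T are exactly the first and the last node, so the periodicity defect of the
       polygon bounds that of the limit. *)
    assert (E0 : fl m 0 = O).
    { unfold fl. rewrite Rdiv_0_l. exact (floor_nat_INR 0). }
    assert (ET : fl m T = K m).
    { unfold fl. rewrite <- (HKh m) at 1.
      replace (INR (K m) * h m / h m) with (INR (K m)) by (field; generalize (Hh m); lra).
      apply floor_nat_INR. }
    assert (H3 := proj2 (Hx0 m) i Hi). simpl in H1, H2. unfold Y in H1, H2.
    rewrite E0 in H1. rewrite ET in H2. simpl in H1.
    apply Rabs_lt_between in H1. apply Rabs_lt_between in H2. apply Rabs_lt_between in H3.
    apply Rabs_le_between. lra.
  - intros t Ht. apply is_derive_Icc_eps. intros e He.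
    destruct (euler_derivative_approx n T M s P (e / 2) HM HP ltac:(lra)) as [d [Hd Ha]].
    exists d; split; [exact Hd|]. intros r Hr Hrd.
    destruct (Req_dec r t) as [->|Hne].
    { rewrite !Rminus_diag, Rmult_0_r, Rminus_0_r, Rabs_R0. lra. }
    assert (HD : 0 < Rabs (r - t)) by (apply Rabs_pos_lt; lra).
    destruct (Ha t r Ht Hr (conj HD Hrd)) as [h0 [Hh0 Hap]].
    destruct HP as [Hs [HPb HPU]].
    destruct (HPU (e / 8) ltac:(lra)) as [d2 [Hd2 H2]].
    set (D := Rabs (r - t)) in *.
    set (q := Rmin d2 (Rmin (e / 8) (e * D / 8))).
    assert (Hq : 0 < q) by (repeat apply Rmin_pos; nra).
    assert (Hq1 : q <= d2) by apply Rmin_l.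
    assert (Hq2 : q <= e / 8) by (eapply Rle_trans; [apply Rmin_r|apply Rmin_l]).
    assert (Hq3 : q <= e * D / 8) by (eapply Rle_trans; [apply Rmin_r|apply Rmin_r]).
    assert (A1 := filterlim_eps U _ _ q HFU (Hx (i, r) Hi Hr) Hq).
    assert (A2 := filter_coord_close U (fun m => Y m t) (fun j => x (j, t)) n q HFU
                    (fun j Hj => Hx (j, t) Hj Ht) Hq).
    assert (A12 := filter_and _ _ A1 A2).
    assert (A := @filter_and _ U HFU _ _ (Hsmall h0 Hh0) A12).
    destruct (filter_ex _ A)
      as [m [[B0 _] [B1 B2]]].
    assert (B3 := Hap (h m) (x0 m) (fl m t) (fl m r) i (conj (Hh m) B0) (proj1 (Hx0 m))
                   (Hfl m t Ht) (Hfl m r Hr) Hi).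
    fold (Y m t) in B3. fold (Y m r) in B3. simpl in B1.
    assert (B4 : Rabs (P i t (Y m t) - P i t (fun j => x (j, t))) < e / 8).
    { apply (H2 t t); auto.
      - rewrite Rminus_diag, Rabs_R0; exact Hd2.
      - intros j Hj. eapply Rlt_le_trans; [apply B2, Hj|exact Hq1]. }
    assert (B5 := B2 i Hi). cbv beta in B5.
    set (p1 := P i t (Y m t)) in *. set (p2 := P i t (fun j => x (j, t))) in *.
    assert (B6 : Rabs (s i * (Y m t i - x (i, t)) + (p1 - p2)) <= e / 4).
    { apply Rabs_lt_between in B4. apply Rabs_lt_between in B5. apply Rabs_le_between.
      destruct (Hs i Hi) as [-> | ->]; lra. }
    assert (B7 : Rabs ((s i * (Y m t i - x (i, t)) + (p1 - p2)) * (r - t)) <= e / 4 * D).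
    { rewrite Rabs_mult. apply Rmult_le_compat_r; [apply Rabs_pos|exact B6]. }
    (* The four terms are at most eD/2, eD/8, eD/8 and eD/4: the estimate for the polygon, its
       distance to the limit at r and at t, and the change of slope. *)
    replace (x (i, r) - x (i, t) - (s i * x (i, t) + p2) * (r - t)) with
      ((Y m r i - Y m t i - (s i * Y m t i + p1) * (r - t))
       - (Y m r i - x (i, r)) + (Y m t i - x (i, t))
       + (s i * (Y m t i - x (i, t)) + (p1 - p2)) * (r - t)) by ring.
    apply Rabs_le_between in B3. apply Rabs_lt_between in B1. apply Rabs_lt_between in B5.
    apply Rabs_le_between in B7. apply Rabs_le_between. lra.
Qed.

(** * Uniform continuity of the truncated right-hand sides *)

Lemma cube_cluster (U : (nat -> Prop) -> Prop) n B (X : nat -> nat -> R) :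
  free_ultrafilter U -> (forall m, in_cube n B (X m)) ->
  exists x, in_cube n B x /\ forall e, 0 < e -> U (fun m => coord_close n e (X m) x).
Proof.
  intros HU HX. assert (HFU : Filter U) by apply HU.
  destruct (functional_choice (fun j l => (j < n)%nat ->
    Rabs l <= B /\ filterlim (fun m => X m j) U (locally l))) as [x Hx].
  { intros j. destruct (classic (j < n)%nat) as [Hj|Hj].
    - destruct (ultrafilter_lim U (fun m => X m j) B HU) as [l Hl];
        [intros m; apply HX, Hj | exists l; auto].
    - exists 0; intros; contradiction. }
  exists x. split.
  - intros j Hj. apply (Hx j Hj).
  - intros e He. apply (filter_coord_close U X x n e HFU); [|exact He].
    intros j Hj. apply (Hx j Hj).
Qed.

Definition continuous_on_cube (n : nat) (B : R) (F : (nat -> R) -> R) : Prop :=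
  forall x, in_cube n B x -> forall e, 0 < e -> exists d, 0 < d /\
    forall y, in_cube n B y -> coord_close n d y x -> Rabs (F y - F x) < e.

Lemma free_ultrafilter_inv U e :
  free_ultrafilter U -> 0 < e -> U (fun m => / (INR m + 1) < e).
Proof.
  intros [HP [_ HU]] He. assert (HFU : Filter U) by apply HP.
  destruct (nfloor_ex (/ e)) as [N [_ HN]]; [apply Rlt_le, Rinv_0_lt_compat, He|].
  generalize (HU N). apply filter_imp. intros m Hm. apply le_INR in Hm.
  rewrite <- (Rinv_inv e). apply Rinv_lt_contravar; [|lra].
  apply Rmult_lt_0_compat; [apply Rinv_0_lt_compat, He|].
  generalize (pos_INR m); lra.
Qed.

(** Otherwise there are pairs of points at distance tending to 0 with values at least [e] apart;
    both members converge along [U] to the same point, against continuity there. *)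
Lemma heine_cube n B F : continuous_on_cube n B F ->
  forall e, 0 < e -> exists d, 0 < d /\ forall x y, in_cube n B x -> in_cube n B y ->
    coord_close n d x y -> Rabs (F x - F y) < e.
Proof.
  intros HF e He. apply NNPP. intros N.
  destruct (functional_choice (fun m (p : (nat -> R) * (nat -> R)) =>
    in_cube n B (fst p) /\ in_cube n B (snd p) /\
    coord_close n (/ (INR m + 1)) (fst p) (snd p) /\ e <= Rabs (F (fst p) - F (snd p))))
    as [p Hp].
  { intros m. apply NNPP. intros C. apply N. exists (/ (INR m + 1)). split.
    - apply Rinv_0_lt_compat. generalize (pos_INR m); lra.
    - intros x y Hx Hy Hxy. apply Rnot_le_lt. intros H. apply C. exists (x, y); auto. }
  destruct free_ultrafilter_ex as [U HU]. assert (HFU : Filter U) by apply HU.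
  assert (HPU : ProperFilter U) by apply HU.
  destruct (cube_cluster U n B (fun m => fst (p m)) HU) as [x [Hx Hc]]; [intros m; apply Hp|].
  destruct (HF x Hx (e / 2) ltac:(lra)) as [d [Hd Hcont]].
  assert (A := @filter_and _ U HFU _ _ (Hc (d / 2) ltac:(lra))
    (free_ultrafilter_inv U (d / 2) HU ltac:(lra))).
  destruct (filter_ex _ A) as [m [H1 H2]].
  destruct (Hp m) as [P1 [P2 [P3 P4]]].
  assert (Q1 : Rabs (F (fst (p m)) - F x) < e / 2).
  { apply Hcont; [exact P1|]. intros j Hj. eapply Rlt_trans; [apply H1, Hj|lra]. }
  assert (Q2 : Rabs (F (snd (p m)) - F x) < e / 2).
  { apply Hcont; [exact P2|]. intros j Hj.
    assert (G1 := H1 j Hj). assert (G2 := P3 j Hj). cbv beta in G1.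
    apply Rabs_lt_between in G1. apply Rabs_lt_between in G2. apply Rabs_lt_between. lra. }
  apply Rabs_lt_between in Q1. apply Rabs_lt_between in Q2.
  apply Rle_not_lt in P4. apply P4, Rabs_lt_between. lra.
Qed.

Lemma bounded_cube n B F : continuous_on_cube n B F ->
  exists M, forall x, in_cube n B x -> Rabs (F x) <= M.
Proof.
  intros HF. apply NNPP. intros N.
  destruct (functional_choice (fun m x => in_cube n B x /\ INR m < Rabs (F x))) as [X HX].
  { intros m. apply NNPP. intros C. apply N. exists (INR m). intros x Hx.
    apply Rnot_lt_le. intros H. apply C. exists x; auto. }
  destruct free_ultrafilter_ex as [U HU]. assert (HFU : Filter U) by apply HU.
  assert (HPU : ProperFilter U) by apply HU.
  destruct (cube_cluster U n B X HU) as [x [Hx Hc]]; [intros m; apply HX|].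
  destruct (HF x Hx 1 ltac:(lra)) as [d [Hd Hcont]].
  destruct (nfloor_ex (Rabs (F x) + 1)) as [k [_ Hk]]; [generalize (Rabs_pos (F x)); lra|].
  assert (A := @filter_and _ U HFU _ _ (Hc d Hd) (proj2 (proj2 HU) (S k))).
  destruct (filter_ex _ A) as [m [H1 H2]].
  assert (Q := Hcont (X m) (proj1 (HX m)) H1). assert (Q2 := proj2 (HX m)).
  apply le_INR in H2. rewrite S_INR in H2.
  assert (T3 := Rabs_triang_inv (F (X m)) (F x)). lra.
Qed.

(** * Projections onto intervals, continuity on [0,T] and truncation *)

Definition clamp (a b x : R) : R := Rmax a (Rmin b x).

Ltac case_clamp :=
  unfold clamp, Rmax, Rmin in *; repeat destruct Rle_dec; try lra.

Lemma clamp_bounds a b x : a <= b -> a <= clamp a b x <= b.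
Proof. intros. case_clamp. Qed.

Lemma clamp_id a b x : a <= x <= b -> clamp a b x = x.
Proof. intros. case_clamp. Qed.

Lemma clamp_below a b x : a <= b -> x <= a -> clamp a b x = a.
Proof. intros. case_clamp. Qed.

Lemma clamp_above a b x : a <= b -> b <= x -> clamp a b x = b.
Proof. intros. case_clamp. Qed.

(** Maximum and minimum are 1-Lipschitz for the sup distance, hence so is [clamp] in its three
    arguments jointly. *)
Lemma clamp_close d a b x a' b' x' :
  Rabs (a - a') < d -> Rabs (b - b') < d -> Rabs (x - x') < d ->
  Rabs (clamp a b x - clamp a' b' x') < d.
Proof.
  rewrite !Rabs_lt_between. intros. case_clamp.
Qed.

Lemma Icc_clamp T t : 0 <= T -> Icc T (clamp 0 T t).
Proof. intros. apply clamp_bounds; lra. Qed.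

Lemma continuous_on_eps (D : R -> Prop) u :
  continuous_on D u <->
  forall t, D t -> forall e, 0 < e -> exists d, 0 < d /\
    forall r, D r -> Rabs (r - t) < d -> Rabs (u r - u t) < e.
Proof.
  split.
  - intros H t Ht e He. specialize (H t Ht).
    assert (A : locally (u t) (fun y => Rabs (y - u t) < e)) by (exists (mkposreal e He); auto).
    destruct (H _ A) as [d Hd]. exists d. split; [apply cond_pos|].
    intros r Hr Hrt. exact (Hd r Hrt Hr).
  - intros H t Ht V [e He]. destruct (H t Ht e (cond_pos e)) as [d [Hd Hc]].
    exists (mkposreal d Hd). intros r Hrt Hr. apply He, Hc; [exact Hr|exact Hrt].
Qed.

Lemma ex_derive_Icc_continuous T u :
  (forall t, Icc T t -> ex_derive_Icc T u t) -> continuous_on (Icc T) u.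
Proof.
  intros H. apply continuous_on_eps. intros t Ht e He.
  destruct (H t Ht) as [l Hl]. destruct (proj1 (is_derive_Icc_eps T u t l) Hl 1 Rlt_0_1)
    as [d [Hd Hu]].
  assert (Pl := Rabs_pos l).
  exists (Rmin d (e / (Rabs l + 1))). split.
  { apply Rmin_pos; [exact Hd|apply Rdiv_lt_0_compat; lra]. }
  intros r Hr Hrt.
  assert (A := Hu r Hr (Rlt_le_trans _ _ _ Hrt (Rmin_l _ _))).
  assert (B := Rlt_le_trans _ _ _ Hrt (Rmin_r _ _)).
  apply Rlt_div_r in B; [|lra].
  replace (u r - u t) with ((u r - u t - l * (r - t)) + l * (r - t)) by ring.
  eapply Rle_lt_trans; [apply Rabs_triang|]. rewrite Rabs_mult. lra.
Qed.

Lemma continuous_on_Icc_uniform T u : 0 <= T -> continuous_on (Icc T) u ->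
  forall e, 0 < e -> exists d, 0 < d /\ forall t r, Icc T t -> Icc T r ->
    Rabs (t - r) < d -> Rabs (u t - u r) < e.
Proof.
  intros HT Hu e He.
  destruct (heine_cube 1 T (fun x => u (clamp 0 T (x O)))) with (e := e) as [d [Hd H]]; auto.
  - intros x _ e' He'.
    destruct (proj1 (continuous_on_eps _ _) Hu _ (Icc_clamp T (x O) HT) e' He') as [d [Hd H]].
    exists d; split; [exact Hd|]. intros y _ Hy. apply H; [apply Icc_clamp, HT|].
    apply clamp_close; [| |apply Hy; lia]; rewrite Rminus_diag, Rabs_R0; exact Hd.
  - exists d; split; [exact Hd|]. intros t r Ht Hr Htr.
    specialize (H (fun _ => t) (fun _ => r)). cbv beta in H.
    rewrite !clamp_id in H by assumption. unfold Icc in *. apply H.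
    + intros j _. rewrite Rabs_pos_eq; lra.
    + intros j _. rewrite Rabs_pos_eq; lra.
    + intros j _. exact Htr.
Qed.

Lemma continuous_rhs_eps T f t z0 w0 z1 w1 e :
  continuous_rhs T f -> Icc T t -> 0 < e -> exists d, 0 < d /\
  forall t' z0' w0' z1' w1', Icc T t' -> Rabs (t' - t) < d ->
    Rabs (z0' - z0) < d -> Rabs (w0' - w0) < d -> Rabs (z1' - z1) < d ->
    Rabs (w1' - w1) < d -> Rabs (f t' z0' w0' z1' w1' - f t z0 w0 z1 w1) < e.
Proof.
  intros Hf Ht He. specialize (Hf (t, z0, w0, z1, w1) Ht).
  assert (A : locally (f t z0 w0 z1 w1) (fun y => Rabs (y - f t z0 w0 z1 w1) < e))
    by (exists (mkposreal e He); auto).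
  destruct (Hf _ A) as [d Hd]. exists d; split; [apply cond_pos|].
  intros t' z0' w0' z1' w1' Ht' H1 H2 H3 H4 H5.
  apply (Hd (t', z0', w0', z1', w1')); [|exact Ht'].
  repeat split; assumption.
Qed.

Definition trunc_rhs (f : rhs) (A1 B1 A2 B2 : R -> R) (N : R) : rhs :=
  fun t z0 w0 z1 w1 => f t (clamp (A1 t) (B1 t) z0) (clamp (A2 t) (B2 t) w0)
                         (clamp (- N) N z1) (clamp (- N) N w1).

Definition uniform_rhs (T : R) (f : rhs) : Prop :=
  forall e, 0 < e -> exists d, 0 < d /\
  forall t z0 w0 z1 w1 t' z0' w0' z1' w1', Icc T t -> Icc T t' ->
    Rabs (t - t') < d -> Rabs (z0 - z0') < d -> Rabs (w0 - w0') < d ->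
    Rabs (z1 - z1') < d -> Rabs (w1 - w1') < d ->
    Rabs (f t z0 w0 z1 w1 - f t' z0' w0' z1' w1') < e.

Definition bounded_by (T C : R) (u : R -> R) : Prop :=
  forall t, Icc T t -> Rabs (u t) <= C.

(** The truncated arguments stay in a fixed cube of R^5, on which Heine's theorem and boundedness
    apply; [clamp_close] and the uniform continuity of the barriers carry this back. Time is
    projected onto [0,T] so that [F] makes sense on the whole cube. *)
Lemma trunc_rhs_regular T f A1 B1 A2 B2 N C :
  0 <= T -> 0 <= N -> continuous_rhs T f ->
  continuous_on (Icc T) A1 -> continuous_on (Icc T) B1 ->
  continuous_on (Icc T) A2 -> continuous_on (Icc T) B2 ->
  bounded_by T C A1 -> bounded_by T C B1 -> bounded_by T C A2 -> bounded_by T C B2 ->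
  (forall t, Icc T t -> A1 t <= B1 t /\ A2 t <= B2 t) ->
  uniform_rhs T (trunc_rhs f A1 B1 A2 B2 N) /\
  exists M, forall t z0 w0 z1 w1, Icc T t ->
    Rabs (trunc_rhs f A1 B1 A2 B2 N t z0 w0 z1 w1) <= M.
Proof.
  intros HT HN Hf cA1 cB1 cA2 cB2 bA1 bB1 bA2 bB2 Hle.
  set (vec := fun (t z0 w0 z1 w1 : R) (j : nat) =>
    match j with 0%nat => t | 1%nat => z0 | 2%nat => w0 | 3%nat => z1 | _ => w1 end).
  set (F := fun x : nat -> R => f (clamp 0 T (x 0%nat)) (x 1%nat) (x 2%nat) (x 3%nat) (x 4%nat)).
  set (B := T + Rabs C + N).
  assert (HF : continuous_on_cube 5 B F).
  { intros x _ e He. unfold F.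
    destruct (continuous_rhs_eps T f (clamp 0 T (x 0%nat)) (x 1%nat) (x 2%nat) (x 3%nat)
      (x 4%nat) e Hf (Icc_clamp T _ HT) He) as [d [Hd H]].
    exists d; split; [exact Hd|]. intros y _ Hy.
    apply H; try (apply Hy; lia).
    - apply Icc_clamp, HT.
    - apply clamp_close; [| |apply Hy; lia]; rewrite Rminus_diag, Rabs_R0; exact Hd. }
  set (tvec := fun t z0 w0 z1 w1 => vec t (clamp (A1 t) (B1 t) z0) (clamp (A2 t) (B2 t) w0)
                         (clamp (- N) N z1) (clamp (- N) N w1)).
  assert (HE : forall t z0 w0 z1 w1, Icc T t ->
    trunc_rhs f A1 B1 A2 B2 N t z0 w0 z1 w1 = F (tvec t z0 w0 z1 w1)).
  { intros. unfold F, tvec, vec. rewrite clamp_id by assumption. reflexivity. }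
  assert (Hcube : forall t z0 w0 z1 w1, Icc T t -> in_cube 5 B (tvec t z0 w0 z1 w1)).
  { intros t z0 w0 z1 w1 Ht.
    assert (PC := Rle_abs C).
    destruct (Hle t Ht) as [L1 L2].
    assert (C1 := clamp_bounds _ _ z0 L1). assert (C2 := clamp_bounds _ _ w0 L2).
    assert (C3 := clamp_bounds (- N) N z1 ltac:(lra)).
    assert (C4 := clamp_bounds (- N) N w1 ltac:(lra)).
    assert (D1 := proj1 (Rabs_le_between _ _) (bA1 t Ht)).
    assert (D2 := proj1 (Rabs_le_between _ _) (bB1 t Ht)).
    assert (D3 := proj1 (Rabs_le_between _ _) (bA2 t Ht)).
    assert (D4 := proj1 (Rabs_le_between _ _) (bB2 t Ht)).
    unfold Icc in Ht.
    intros j Hj. apply Rabs_le_between. unfold tvec, B.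
    destruct j as [|[|[|[|j]]]]; cbn [vec]; lra. }
  split.
  - intros e He.
    destruct (heine_cube 5 B F HF e He) as [d [Hd H]].
    destruct (continuous_on_Icc_uniform T A1 HT cA1 d Hd) as [d1 [Hd1 H1]].
    destruct (continuous_on_Icc_uniform T B1 HT cB1 d Hd) as [d2 [Hd2 H2]].
    destruct (continuous_on_Icc_uniform T A2 HT cA2 d Hd) as [d3 [Hd3 H3]].
    destruct (continuous_on_Icc_uniform T B2 HT cB2 d Hd) as [d4 [Hd4 H4]].
    exists (Rmin d (Rmin (Rmin d1 d2) (Rmin d3 d4))).
    split; [repeat apply Rmin_pos; assumption|].
    intros t z0 w0 z1 w1 t' z0' w0' z1' w1' Ht Ht'.
    intros E0 E1 E2 E3 E4.
    assert (M0 := Rmin_l d (Rmin (Rmin d1 d2) (Rmin d3 d4))).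
    assert (M1 := Rmin_r d (Rmin (Rmin d1 d2) (Rmin d3 d4))).
    assert (M2 := Rmin_l (Rmin d1 d2) (Rmin d3 d4)).
    assert (M3 := Rmin_r (Rmin d1 d2) (Rmin d3 d4)).
    assert (M4 := Rmin_l d1 d2). assert (M5 := Rmin_r d1 d2).
    assert (M6 := Rmin_l d3 d4). assert (M7 := Rmin_r d3 d4).
    rewrite !HE by assumption. apply H; [apply Hcube, Ht|apply Hcube, Ht'|].
    assert (Z : Rabs (N - N) < d /\ Rabs (- N - - N) < d)
      by (rewrite !Rminus_diag, Rabs_R0; lra).
    intros j Hj. unfold tvec. destruct j as [|[|[|[|j]]]]; cbn [vec].
    + lra.
    + apply clamp_close; [apply H1|apply H2|]; auto; lra.
    + apply clamp_close; [apply H3|apply H4|]; auto; lra.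
    + apply clamp_close; lra.
    + apply clamp_close; lra.
  - destruct (bounded_cube 5 B F HF) as [M HM]. exists M. intros.
    rewrite HE by assumption. apply HM, Hcube. assumption.
Qed.

(** * Minimum principle and Nagumo bound *)

Lemma is_derive_Icc_ext T u v t l :
  Icc T t -> (forall r, Icc T r -> u r = v r) -> is_derive_Icc T u t l -> is_derive_Icc T v t l.
Proof.
  intros Ht E H. apply is_derive_Icc_eps. intros e He.
  destruct (proj1 (is_derive_Icc_eps _ _ _ _) H e He) as [d [Hd Hu]].
  exists d; split; [exact Hd|]. intros r Hr. rewrite <- !E by assumption. apply Hu, Hr.
Qed.

Lemma is_derive_Icc_minus T u v t l m :
  is_derive_Icc T u t l -> is_derive_Icc T v t m ->
  is_derive_Icc T (fun r => u r - v r) t (l - m).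
Proof. exact (Dminus _ _ _ u v t). Qed.

Lemma is_derive_Icc_plus T u v t l m :
  is_derive_Icc T u t l -> is_derive_Icc T v t m ->
  is_derive_Icc T (fun r => u r + v r) t (l + m).
Proof. exact (Dadd _ _ _ u v t). Qed.

Lemma is_derive_Icc_scal T a u t l :
  is_derive_Icc T u t l -> is_derive_Icc T (fun r => a * u r) t (a * l).
Proof. exact (Dmult_const _ u _ t a). Qed.

Lemma is_derive_Icc_plus_const T u c t l :
  is_derive_Icc T u t l -> is_derive_Icc T (fun r => u r + c) t l.
Proof.
  intros H. replace l with (l + 0) by ring. apply is_derive_Icc_plus; [exact H|].
  exact (Dconst _ c t).
Qed.

(** The mean value theorem for the extension of [u] by [clamp]: interior points of [a,b] are
    interior to [0,T], where the relative derivative is the ordinary one. *)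
Lemma MVT_Icc T u v a b :
  (forall t, Icc T t -> is_derive_Icc T u t (v t)) -> Icc T a -> Icc T b -> a < b ->
  exists c, a <= c <= b /\ u b - u a = v c * (b - a).
Proof.
  intros Hu Ha Hb Hab. assert (HT : 0 <= T) by (unfold Icc in *; lra).
  assert (Cu : continuous_on (Icc T) u)
    by (apply ex_derive_Icc_continuous; intros t Ht; exists (v t); auto).
  destruct (MVT_gen (fun t => u (clamp 0 T t)) a b v) as [c [Hc E]].
  - rewrite Rmin_left, Rmax_right by lra. intros x Hx.
    assert (Hx' : 0 < x < T) by (unfold Icc in *; lra).
    assert (Ix : Icc T x) by (unfold Icc; lra).
    apply is_derive_Reals. intros e He.
    destruct (proj1 (is_derive_Icc_eps _ _ _ _) (Hu x Ix) (e / 2) ltac:(lra))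
      as [d [Hd Hl]].
    assert (Pd : 0 < Rmin d (Rmin x (T - x))) by (repeat apply Rmin_pos; lra).
    exists (mkposreal _ Pd). simpl. intros h Hh0 Hh.
    assert (R0 := Rlt_le_trans _ _ _ Hh (Rmin_l _ _)).
    assert (R1 := Rlt_le_trans _ _ _ Hh (Rmin_r _ _)).
    assert (R2 := Rlt_le_trans _ _ _ R1 (Rmin_l _ _)).
    assert (R3 := Rlt_le_trans _ _ _ R1 (Rmin_r _ _)).
    apply Rabs_lt_between in R2. apply Rabs_lt_between in R3.
    assert (Ixh : Icc T (x + h)) by (unfold Icc; lra).
    rewrite !clamp_id by assumption.
    specialize (Hl (x + h) Ixh). replace (x + h - x) with h in Hl by ring.
    specialize (Hl R0).
    assert (P : 0 < Rabs h) by (apply Rabs_pos_lt; lra).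
    replace ((u (x + h) - u x) / h - v x) with ((u (x + h) - u x - v x * h) / h)
      by (field; lra).
    unfold Rdiv at 1. rewrite Rabs_mult, Rabs_inv.
    apply Rle_lt_trans with (e / 2); [|lra]. apply Rle_div_l; lra.
  - intros x _. apply continuity_pt_filterlim.
    intros V [e He].
    destruct (proj1 (continuous_on_eps _ _) Cu (clamp 0 T x) (Icc_clamp T x HT) e (cond_pos e))
      as [d [Hd Hc]].
    exists (mkposreal d Hd). intros r Hr. apply He, Hc; [apply Icc_clamp, HT|].
    apply clamp_close; [| |exact Hr]; rewrite Rminus_diag, Rabs_R0; exact Hd.
  - rewrite Rmin_left, Rmax_right in Hc by lra.
    exists c. split; [exact Hc|]. rewrite !clamp_id in E by assumption. exact E.
Qed.

Lemma right_slope_nonneg T y t l :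
  is_derive_Icc T y t l -> Icc T t -> t < T -> (forall r, Icc T r -> y t <= y r) -> 0 <= l.
Proof.
  intros H Ht HtT Hmin. apply Rnot_lt_le. intros Hl.
  destruct (proj1 (is_derive_Icc_eps _ _ _ _) H (- l / 2) ltac:(lra)) as [d [Hd Hs]].
  set (h := Rmin (d / 2) (T - t)).
  assert (Hh : 0 < h) by (apply Rmin_pos; lra).
  assert (h <= d / 2) by apply Rmin_l. assert (h <= T - t) by apply Rmin_r.
  assert (I : Icc T (t + h)) by (unfold Icc in *; lra).
  specialize (Hs (t + h) I). replace (t + h - t) with h in Hs by ring.
  rewrite (Rabs_pos_eq h) in Hs by lra.
  specialize (Hs ltac:(lra)). apply Rabs_le_between in Hs.
  specialize (Hmin (t + h) I). nra.
Qed.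

Lemma left_slope_nonpos T y t l :
  is_derive_Icc T y t l -> Icc T t -> 0 < t -> (forall r, Icc T r -> y t <= y r) -> l <= 0.
Proof.
  intros H Ht Ht0 Hmin. apply Rnot_lt_le. intros Hl.
  destruct (proj1 (is_derive_Icc_eps _ _ _ _) H (l / 2) ltac:(lra)) as [d [Hd Hs]].
  set (h := Rmin (d / 2) t).
  assert (Hh : 0 < h) by (apply Rmin_pos; lra).
  assert (h <= d / 2) by apply Rmin_l. assert (h <= t) by apply Rmin_r.
  assert (I : Icc T (t - h)) by (unfold Icc in *; lra).
  specialize (Hs (t - h) I). replace (t - h - t) with (- h) in Hs by ring.
  rewrite Rabs_Ropp, (Rabs_pos_eq h) in Hs by lra.
  specialize (Hs ltac:(lra)). apply Rabs_le_between in Hs.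
  specialize (Hmin (t - h) I). nra.
Qed.

(** At a negative interior minimum y' = 0. If the minimum is at an endpoint, both endpoints are
    minima and 0 <= y'(0) <= y'(T) <= 0. In either case there is such a point t1 < T, and y''(t1) <
    0 makes y drop below its minimum to the right of it. *)
Lemma periodic_minimum_principle T y y1 y2 :
  0 < T ->
  (forall t, Icc T t -> is_derive_Icc T y t (y1 t)) ->
  (forall t, Icc T t -> is_derive_Icc T y1 t (y2 t)) ->
  y 0 = y T -> y1 0 <= y1 T ->
  (forall t, Icc T t -> y t < 0 -> y1 t = 0 -> y2 t < 0) ->
  forall t, Icc T t -> 0 <= y t.
Proof.
  intros HT D1 D2 Hp Hp1 Hneg t Ht. apply Rnot_lt_le. intros Hyt.
  destruct (min_Icc_spec T y) as [[t0 [Ht0 E0]] Hmin]; [lra| |].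
  { apply ex_derive_Icc_continuous. intros r Hr; exists (y1 r); auto. }
  rewrite <- E0 in Hmin. assert (Hy0 := Hmin t Ht).
  assert (I0 : Icc T 0) by (unfold Icc; lra). assert (IT : Icc T T) by (unfold Icc; lra).
  assert (H1 : exists t1, Icc T t1 /\ t1 < T /\ y t1 = y t0 /\ y1 t1 = 0).
  { destruct (classic (0 < t0 < T)) as [Hint|Hbd].
    - exists t0. repeat split; try apply Ht0; try lra.
      apply Rle_antisym.
      + apply (left_slope_nonpos T y t0); auto; lra.
      + apply (right_slope_nonneg T y t0); auto; lra.
    - assert (E : y t0 = y 0).
      { destruct (Req_dec t0 0) as [->|]; [reflexivity|].
        rewrite Hp. f_equal. unfold Icc in Ht0; lra. }
      rewrite E in Hmin.
      assert (S0 : 0 <= y1 0) by (apply (right_slope_nonneg T y 0); auto).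
      assert (ST : y1 T <= 0).
      { apply (left_slope_nonpos T y T); auto. rewrite <- Hp; exact Hmin. }
      exists 0. repeat split; try lra; auto. }
  destruct H1 as [t1 [It1 [Ht1 [E1 Hd]]]]. rewrite <- E1 in Hmin.
  assert (H2 := Hneg t1 It1 ltac:(lra) Hd).
  destruct (proj1 (is_derive_Icc_eps _ _ _ _) (D2 t1 It1) (- y2 t1 / 2) ltac:(lra))
    as [d [Hd0 Hs]].
  set (h := Rmin (d / 2) (T - t1)).
  assert (Hh : 0 < h) by (apply Rmin_pos; lra).
  assert (Hh1 : h <= d / 2) by apply Rmin_l. assert (Hh2 : h <= T - t1) by apply Rmin_r.
  assert (Hdec : forall r, t1 <= r <= t1 + h -> y1 r <= y2 t1 / 2 * (r - t1)).
  { intros r Hr.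
    specialize (Hs r ltac:(unfold Icc in *; lra)).
    rewrite (Rabs_pos_eq (r - t1)) in Hs by lra.
    specialize (Hs ltac:(lra)). apply Rabs_le_between in Hs. lra. }
  (* The mean value point may be t1 itself, where the slope is 0; the second half of the interval
     provides a strict decrease. *)
  destruct (MVT_Icc T y y1 t1 (t1 + h / 2) D1) as [c [Hc Ec]];
    [exact It1 | unfold Icc in *; lra | lra |].
  destruct (MVT_Icc T y y1 (t1 + h / 2) (t1 + h) D1) as [c' [Hc' Ec']];
    [unfold Icc in *; lra | unfold Icc in *; lra | lra |].
  assert (G := Hdec c ltac:(lra)). assert (G' := Hdec c' ltac:(lra)).
  specialize (Hmin (t1 + h) ltac:(unfold Icc in *; lra)).
  assert (y1 c <= 0) by nra. assert (y1 c' < 0) by nra. nra.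
Qed.

(** By periodicity [v] vanishes at some [r], where Phi(v) = 0. Since Phi(v) is 1-Lipschitz, it is at
    most T in absolute value, whereas [v t >= N] would give Phi(v(t)) >= Phi(N) > T. The clamp in
    the bound on [a] matches the truncated system. *)
Lemma nagumo_upper T N phi u v a :
  0 < T -> 0 <= N -> nagumo_function phi ->
  T < RInt (fun s => / phi s) 0 N ->
  (forall t, Icc T t -> is_derive_Icc T u t (v t)) ->
  (forall t, Icc T t -> is_derive_Icc T v t (a t)) ->
  u 0 = u T ->
  (forall t, Icc T t -> Rabs (a t) <= phi (Rabs (clamp (- N) N (v t)))) ->
  forall t, Icc T t -> v t < N.
Proof.
  intros HT HN [Cphi [Pphi _]] HI Du Dv Hp Ha t Ht.
  apply Rnot_le_lt. intros HvN.
  (* A positive continuous extension to all of R of the restriction of 1/phi to [0,N]. *)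
  set (psi := fun s => / phi (Rabs (clamp (- N) N s))).
  assert (Ppsi : forall s, 0 < psi s).
  { intros s. apply Rinv_0_lt_compat, Pphi, Rabs_pos. }
  assert (Cpsi : forall s, continuous psi s).
  { intros s. apply (continuous_comp (fun s => phi (Rabs (clamp (- N) N s))) Rinv).
    - intros V [e He].
      destruct (proj1 (continuous_on_eps _ _) Cphi (Rabs (clamp (- N) N s)) (Rabs_pos _)
        e (cond_pos e)) as [d [Hd Hc]].
      exists (mkposreal d Hd). intros r Hr. apply He, Hc; [apply Rabs_pos|].
      eapply Rle_lt_trans; [apply Rabs_triang_inv2|].
      apply clamp_close; [| |exact Hr]; rewrite Rminus_diag, Rabs_R0; exact Hd.
    - apply continuous_Rinv. apply Rgt_not_eq, Pphi, Rabs_pos. }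
  assert (Ipsi : forall p q, ex_RInt psi p q) by (intros; apply (@ex_RInt_continuous R_CompleteNormedModule); auto).
  set (Phi := fun y => RInt psi 0 y).
  assert (DPhi : forall y, is_derive Phi y (psi y)).
  { intros y. apply (is_derive_RInt psi Phi 0).
    - apply filter_forall. intros z. apply (@RInt_correct R_CompleteNormedModule psi), Ipsi.
    - apply Cpsi. }
  assert (Dh : forall r, Icc T r -> is_derive_Icc T (fun t => Phi (v t)) r (a r * psi (v r))).
  { intros r Hr.
    assert (H1 : D_in Phi psi no_cond (v r)).
    { apply derivable_pt_lim_D_in, is_derive_Reals, DPhi. }
    assert (H2 := Dcomp (Icc T) no_cond (fun _ => a r) psi v Phi r (Dv r Hr) H1).
    intros e He. destruct (H2 e He) as [d [Hd H3]]. exists d; split; [exact Hd|].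
    intros x [[Hx Hne] Hxr]. apply H3. repeat split; auto; apply Hx. }
  destruct (MVT_Icc T u v 0 T Du) as [r [Ir Er]]; try (unfold Icc; lra).
  assert (Ir' : Icc T r) by exact Ir.
  assert (Hr0 : v r = 0) by nra.
  assert (Lip : forall p q, Icc T p -> Icc T q -> p < q ->
    Rabs (Phi (v q) - Phi (v p)) <= T).
  { intros p q Hp' Hq' Hpq.
    destruct (MVT_Icc T (fun t => Phi (v t)) (fun r => a r * psi (v r)) p q Dh Hp' Hq' Hpq)
      as [c [Hc ->]].
    assert (Ic : Icc T c) by (unfold Icc in *; lra).
    assert (Q : Rabs (a c * psi (v c)) <= 1).
    { rewrite Rabs_mult, (Rabs_pos_eq (psi (v c))) by apply Rlt_le, Ppsi.
      unfold psi. apply Rle_div_l; [apply Pphi, Rabs_pos|].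
      rewrite Rmult_1_l. apply Ha, Ic. }
    rewrite Rabs_mult, (Rabs_pos_eq (q - p)) by lra.
    unfold Icc in *. assert (0 <= q - p <= T) by lra.
    assert (0 <= Rabs (a c * psi (v c))) by apply Rabs_pos. nra. }
  assert (Hle : Rabs (Phi (v t) - Phi (v r)) <= T).
  { destruct (Rtotal_order r t) as [H|[->|H]].
    - apply Lip; auto.
    - rewrite Rminus_diag, Rabs_R0; lra.
    - rewrite Rabs_minus_sym. apply Lip; auto. }
  assert (E0 : Phi (v r) = 0).
  { rewrite Hr0. exact (RInt_point 0 psi). }
  assert (EN : Phi N = RInt (fun s => / phi s) 0 N).
  { apply RInt_ext. intros s. rewrite Rmin_left, Rmax_right by exact HN. intros Hs.
    unfold psi. rewrite clamp_id, Rabs_pos_eq by lra. reflexivity. }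
  assert (EC : Phi (v t) = Phi N + RInt psi N (v t)).
  { symmetry. exact (RInt_Chasles psi 0 N (v t) (Ipsi _ _) (Ipsi _ _)). }
  assert (0 <= RInt psi N (v t)).
  { apply RInt_ge_0; [exact HvN|apply Ipsi|]. intros; apply Rlt_le, Ppsi. }
  apply Rabs_le_between in Hle. lra.
Qed.

Lemma nagumo_bound T N phi u v a :
  0 < T -> 0 <= N -> nagumo_function phi ->
  T < RInt (fun s => / phi s) 0 N ->
  (forall t, Icc T t -> is_derive_Icc T u t (v t)) ->
  (forall t, Icc T t -> is_derive_Icc T v t (a t)) ->
  u 0 = u T ->
  (forall t, Icc T t -> Rabs (a t) <= phi (Rabs (clamp (- N) N (v t)))) ->
  forall t, Icc T t -> - N < v t < N.
Proof.
  intros HT HN Hphi HI Du Dv Hp Ha t Ht. split.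
  - assert (A : -1 * v t < N); [|lra].
    revert t Ht. apply (nagumo_upper T N phi (fun t => -1 * u t) (fun t => -1 * v t)
                          (fun t => -1 * a t)); auto.
    + intros; apply is_derive_Icc_scal; auto.
    + intros; apply is_derive_Icc_scal; auto.
    + intros; lra.
    + intros t Ht.
      replace (clamp (- N) N (-1 * v t)) with (-1 * clamp (- N) N (v t)) by case_clamp.
      rewrite !Rabs_mult, Rabs_m1, !Rmult_1_l. apply Ha, Ht.
  - revert t Ht. apply (nagumo_upper T N phi u v a); auto.
Qed.

(** * The periodic problem *)

Lemma continuous_rhs_minus T (f k : rhs) :
  continuous_rhs T f -> continuous_rhs T k ->
  continuous_rhs T (fun t z0 w0 z1 w1 => f t z0 w0 z1 w1 - k t z0 w0 z1 w1).
Proof.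
  intros Hf Hk p Hp.
  apply (filterlim_ext (fun p : R * R * R * R * R =>
    plus (let '(t, z0, w0, z1, w1) := p in f t z0 w0 z1 w1)
         (opp (let '(t, z0, w0, z1, w1) := p in k t z0 w0 z1 w1)))).
  { intros [[[[t z0] w0] z1] w1]. reflexivity. }
  eapply filterlim_comp_2; [exact (Hf p Hp)| |].
  - eapply filterlim_comp; [exact (Hk p Hp)|]. apply (@filterlim_opp _ R_NormedModule).
  - destruct p as [[[[t z0] w0] z1] w1]. apply (@filterlim_plus _ R_NormedModule).
Qed.

(** The coordinates 0, 1, 2, 3 are z' - z, z' + z, w' - w, w' + w. Even ones have linear part -1,
    odd ones +1, and both coordinates of a pair carry the same perturbation. *)
Lemma periodic_regularized T (F G : rhs) MF MG :
  0 < T -> uniform_rhs T F -> uniform_rhs T G ->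
  (forall t z0 w0 z1 w1, Icc T t -> Rabs (F t z0 w0 z1 w1) <= MF) ->
  (forall t z0 w0 z1 w1, Icc T t -> Rabs (G t z0 w0 z1 w1) <= MG) ->
  exists z z1 w w1 : R -> R,
    (z 0 = z T /\ z1 0 = z1 T /\ w 0 = w T /\ w1 0 = w1 T) /\
    forall t, Icc T t ->
      is_derive_Icc T z t (z1 t) /\
      is_derive_Icc T z1 t (z t + F t (z t) (w t) (z1 t) (w1 t)) /\
      is_derive_Icc T w t (w1 t) /\
      is_derive_Icc T w1 t (w t + G t (z t) (w t) (z1 t) (w1 t)).
Proof.
  intros HT UF UG BF BG.
  set (H := fun (K : rhs) t (x : nat -> R) =>
    K t (/ 2 * (x 1%nat - x 0%nat)) (/ 2 * (x 3%nat - x 2%nat))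
        (/ 2 * (x 1%nat + x 0%nat)) (/ 2 * (x 3%nat + x 2%nat))).
  set (P := fun (i : nat) => H (if Nat.ltb i 2 then F else G)).
  set (s := fun i : nat => if Nat.even i then -1 else 1).
  assert (UH : forall K, uniform_rhs T K -> forall e, 0 < e -> exists d, 0 < d /\
    forall t t' x y, Icc T t -> Icc T t' -> Rabs (t - t') < d -> coord_close 4 d x y ->
      Rabs (H K t x - H K t' y) < e).
  { intros K HK e He. destruct (HK e He) as [d [Hd Hc]]. exists d; split; [exact Hd|].
    intros t t' x y Ht Ht' Htt Hxy.
    assert (E0 := proj1 (Rabs_lt_between _ _) (Hxy 0%nat ltac:(lia))).
    assert (E1 := proj1 (Rabs_lt_between _ _) (Hxy 1%nat ltac:(lia))).
    assert (E2 := proj1 (Rabs_lt_between _ _) (Hxy 2%nat ltac:(lia))).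
    assert (E3 := proj1 (Rabs_lt_between _ _) (Hxy 3%nat ltac:(lia))).
    apply Hc; auto; apply Rabs_lt_between; lra. }
  (* A common bound for F and G, made strictly positive by the 1. *)
  destruct (periodic_bounded_perturbation 4 T (Rabs MF + Rabs MG + 1) s P) as [x Hx].
  - exact HT.
  - generalize (Rabs_pos MF) (Rabs_pos MG); lra.
  - split; [|split].
    + intros i _. unfold s. destruct (Nat.even i); lra.
    + intros i t y _ Ht. unfold P, H.
      assert (A1 := Rle_abs MF). assert (A2 := Rle_abs MG).
      assert (A3 := Rabs_pos MF). assert (A4 := Rabs_pos MG).
      destruct (Nat.ltb i 2); eapply Rle_trans; try (apply BF; exact Ht); try (apply BG; exact Ht); lra.
    + intros e He. destruct (UH F UF e He) as [d1 [Hd1 H1]].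
      destruct (UH G UG e He) as [d2 [Hd2 H2]].
      exists (Rmin d1 d2). split; [apply Rmin_pos; assumption|].
      intros t t' y y' Ht Ht' Htt Hyy i _. unfold P.
      destruct (Nat.ltb i 2).
      * apply H1; auto; [|intros j Hj]; eapply Rlt_le_trans; try apply Rmin_l; eauto.
      * apply H2; auto; [|intros j Hj]; eapply Rlt_le_trans; try apply Rmin_r; eauto.
  - destruct (Hx 0%nat ltac:(lia)) as [p0 D0]. destruct (Hx 1%nat ltac:(lia)) as [p1 D1].
    destruct (Hx 2%nat ltac:(lia)) as [p2 D2]. destruct (Hx 3%nat ltac:(lia)) as [p3 D3].
    exists (fun t => / 2 * (x 1%nat t - x 0%nat t)), (fun t => / 2 * (x 1%nat t + x 0%nat t)),
           (fun t => / 2 * (x 3%nat t - x 2%nat t)), (fun t => / 2 * (x 3%nat t + x 2%nat t)).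
    split; [repeat split; congruence|].
    intros t Ht. specialize (D0 t Ht). specialize (D1 t Ht).
    specialize (D2 t Ht). specialize (D3 t Ht).
    unfold P, H, s in D0, D1, D2, D3. simpl in D0, D1, D2, D3.
    set (f := F t _ _ _ _) in *. set (g := G t _ _ _ _) in *.
    assert (E : forall u v l m r, is_derive_Icc T u t l -> is_derive_Icc T v t m ->
      r = / 2 * (l - m) -> is_derive_Icc T (fun t => / 2 * (u t - v t)) t r).
    { intros u v l m r Hu Hv ->. apply is_derive_Icc_scal, is_derive_Icc_minus; assumption. }
    assert (E' : forall u v l m r, is_derive_Icc T u t l -> is_derive_Icc T v t m ->
      r = / 2 * (l + m) -> is_derive_Icc T (fun t => / 2 * (u t + v t)) t r).
    { intros u v l m r Hu Hv ->. apply is_derive_Icc_scal, is_derive_Icc_plus; assumption. }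
    repeat split.
    + apply (E _ _ _ _ _ D1 D0). lra.
    + apply (E' _ _ _ _ _ D1 D0). lra.
    + apply (E _ _ _ _ _ D3 D2). lra.
    + apply (E' _ _ _ _ _ D3 D2). lra.
Qed.

(** Stated for one component, so that it serves for f and, with the unknowns exchanged, for g. Where
    z < A and z' = A', the clamp leaves z' = A' unchanged because |A'| <= N. Monotonicity and C <=
    clamp(o) then give A'' >= k(t, A, clamp(o), A', q), so (z - A)'' <= z - A < 0. The bound by B is
    symmetric. *)
Lemma solution_between T N (k : rhs) (A A1 A2 B B1 B2 C D z z1 o o1 : R -> R) :
  0 < T ->
  (forall t, Icc T t -> is_derive_Icc T z t (z1 t)) ->
  (forall t, Icc T t -> is_derive_Icc T z1 t
     (z t + (k t (clamp (A t) (B t) (z t)) (clamp (C t) (D t) (o t))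
               (clamp (- N) N (z1 t)) (clamp (- N) N (o1 t)) - clamp (A t) (B t) (z t)))) ->
  z 0 = z T -> z1 0 = z1 T ->
  (forall t, Icc T t -> is_derive_Icc T A t (A1 t)) ->
  (forall t, Icc T t -> is_derive_Icc T A1 t (A2 t)) ->
  A 0 = A T -> A1 0 >= A1 T ->
  (forall t q, Icc T t -> A2 t >= k t (A t) (C t) (A1 t) q) ->
  (forall t, Icc T t -> is_derive_Icc T B t (B1 t)) ->
  (forall t, Icc T t -> is_derive_Icc T B1 t (B2 t)) ->
  B 0 = B T -> B1 0 <= B1 T ->
  (forall t q, Icc T t -> B2 t <= k t (B t) (D t) (B1 t) q) ->
  (forall t, Icc T t -> A t <= B t /\ C t <= D t) ->
  (forall t, Icc T t -> Rabs (A1 t) <= N /\ Rabs (B1 t) <= N) ->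
  (forall t p0 p1 q1, Icc T t -> p1 = A1 t \/ p1 = B1 t ->
     forall q0 q0', q0 <= q0' -> k t p0 q0' p1 q1 <= k t p0 q0 p1 q1) ->
  forall t, Icc T t -> A t <= z t <= B t.
Proof.
  intros HT Dz Dz1 Pz Pz1 DA DA1 PA PA1 LA DB DB1 PB PB1 UB Hle HN Hmon t Ht.
  split.
  - assert (E : 0 <= z t - A t); [|lra].
    revert t Ht. refine (periodic_minimum_principle T (fun t => z t - A t) (fun t => z1 t - A1 t)
      _ HT (fun t Ht => is_derive_Icc_minus _ _ _ _ _ _ (Dz t Ht) (DA t Ht))
      (fun t Ht => is_derive_Icc_minus _ _ _ _ _ _ (Dz1 t Ht) (DA1 t Ht)) _ _ _); try lra.
    intros t Ht H0 H1. destruct (Hle t Ht) as [L1 L2]. destruct (HN t Ht) as [N1 _].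
    apply Rabs_le_between in N1.
    rewrite (clamp_below (A t)) by lra.
    replace (z1 t) with (A1 t) by lra. rewrite (clamp_id _ _ (A1 t)) by exact N1.
    set (q := clamp (- N) N (o1 t)).
    assert (M := Hmon t (A t) (A1 t) q Ht (or_introl eq_refl) (C t) (clamp (C t) (D t) (o t))
      (proj1 (clamp_bounds _ _ _ L2))).
    specialize (LA t q Ht). lra.
  - assert (E : 0 <= B t - z t); [|lra].
    revert t Ht. refine (periodic_minimum_principle T (fun t => B t - z t) (fun t => B1 t - z1 t)
      _ HT (fun t Ht => is_derive_Icc_minus _ _ _ _ _ _ (DB t Ht) (Dz t Ht))
      (fun t Ht => is_derive_Icc_minus _ _ _ _ _ _ (DB1 t Ht) (Dz1 t Ht)) _ _ _); try lra.
    intros t Ht H0 H1. destruct (Hle t Ht) as [L1 L2]. destruct (HN t Ht) as [_ N1].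
    apply Rabs_le_between in N1.
    rewrite (clamp_above (A t)) by lra.
    replace (z1 t) with (B1 t) by lra. rewrite (clamp_id _ _ (B1 t)) by exact N1.
    set (q := clamp (- N) N (o1 t)).
    assert (M := Hmon t (B t) (B1 t) q Ht (or_intror eq_refl) (clamp (C t) (D t) (o t)) (D t)
      (proj2 (clamp_bounds _ _ _ L2))).
    specialize (UB t q Ht). lra.
Qed.

(** * Norm bounds and regularity of functions on [0,T] *)

Lemma norm_Icc_bound T u : 0 <= T -> continuous_on (Icc T) u -> bounded_by T (norm_Icc T u) u.
Proof.
  intros HT Hu t Ht. apply (max_Icc_spec T (fun t => Rabs (u t)) HT); [|exact Ht].
  apply continuous_on_eps. intros r Hr e He.
  destruct (proj1 (continuous_on_eps _ _) Hu r Hr e He) as [d [Hd H]].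
  exists d; split; [exact Hd|]. intros q Hq Hqr.
  eapply Rle_lt_trans; [apply Rabs_triang_inv2|]. apply H; assumption.
Qed.

Lemma ex_derive_Icc_correct T u t :
  0 < T -> Icc T t -> ex_derive_Icc T u t -> is_derive_Icc T u t (Derive_Icc T u t).
Proof.
  intros HT Ht [l Hl]. rewrite (Derive_Icc_unique T u t l HT Ht Hl). exact Hl.
Qed.

Lemma C2_Icc_intro T u u1 u2 : 0 < T ->
  (forall t, Icc T t -> is_derive_Icc T u t (u1 t)) ->
  (forall t, Icc T t -> is_derive_Icc T u1 t (u2 t)) ->
  continuous_on (Icc T) u2 ->
  C2_Icc T u /\ (forall t, Icc T t -> Derive_Icc T u t = u1 t) /\
  (forall t, Icc T t -> Derive_Icc T (Derive_Icc T u) t = u2 t).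
Proof.
  intros HT H1 H2 Hc.
  assert (E1 : forall t, Icc T t -> Derive_Icc T u t = u1 t)
    by (intros; apply Derive_Icc_unique; auto).
  assert (H2' : forall t, Icc T t -> is_derive_Icc T (Derive_Icc T u) t (u2 t)).
  { intros t Ht. apply (is_derive_Icc_ext T u1); auto. intros; symmetry; auto. }
  assert (E2 : forall t, Icc T t -> Derive_Icc T (Derive_Icc T u) t = u2 t)
    by (intros; apply Derive_Icc_unique; auto).
  split; [|split; assumption]. split; split.
  - intros t Ht; exists (u1 t); auto.
  - apply ex_derive_Icc_continuous. intros t Ht; exists (u2 t); auto.
  - intros t Ht; exists (u2 t); auto.
  - apply continuous_on_eps. intros t Ht e He.
    destruct (proj1 (continuous_on_eps _ _) Hc t Ht e He) as [d [Hd H]].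
    exists d; split; [exact Hd|]. intros r Hr. rewrite !E2 by assumption. apply H, Hr.
Qed.

Lemma continuous_rhs_comp T f z w z1 w1 : continuous_rhs T f ->
  continuous_on (Icc T) z -> continuous_on (Icc T) w ->
  continuous_on (Icc T) z1 -> continuous_on (Icc T) w1 ->
  continuous_on (Icc T) (fun t => f t (z t) (w t) (z1 t) (w1 t)).
Proof.
  intros Hf Hz Hw Hz1 Hw1. apply continuous_on_eps. intros t Ht e He.
  destruct (continuous_rhs_eps T f t (z t) (w t) (z1 t) (w1 t) e Hf Ht He) as [d [Hd H]].
  destruct (proj1 (continuous_on_eps _ _) Hz t Ht d Hd) as [d1 [Hd1 H1]].
  destruct (proj1 (continuous_on_eps _ _) Hw t Ht d Hd) as [d2 [Hd2 H2]].
  destruct (proj1 (continuous_on_eps _ _) Hz1 t Ht d Hd) as [d3 [Hd3 H3]].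
  destruct (proj1 (continuous_on_eps _ _) Hw1 t Ht d Hd) as [d4 [Hd4 H4]].
  exists (Rmin d (Rmin (Rmin d1 d2) (Rmin d3 d4))).
  split; [repeat apply Rmin_pos; assumption|]. intros r Hr Hrt.
  assert (M0 := Rmin_l d (Rmin (Rmin d1 d2) (Rmin d3 d4))).
  assert (M1 := Rmin_r d (Rmin (Rmin d1 d2) (Rmin d3 d4))).
  assert (M2 := Rmin_l (Rmin d1 d2) (Rmin d3 d4)).
  assert (M3 := Rmin_r (Rmin d1 d2) (Rmin d3 d4)).
  assert (M4 := Rmin_l d1 d2). assert (M5 := Rmin_r d1 d2).
  assert (M6 := Rmin_l d3 d4). assert (M7 := Rmin_r d3 d4).
  apply H; [exact Hr| |apply H1|apply H2|apply H3|apply H4]; auto; lra.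
Qed.

Lemma nagumo_function_large phi T : nagumo_function phi ->
  exists N0, forall N, N0 < N -> T < RInt (fun s => / phi s) 0 N.
Proof.
  intros [_ [_ H]]. apply is_lim_spec in H. exact (H T).
Qed.

(** * Existence and localization of a periodic solution *)

Theorem theorem4 (T : R) (f g : rhs) (a1 a2 b1 b2 : R -> R)
  (hT : 0 < T)
  (hf : continuous_rhs T f)
  (hg : continuous_rhs T g)
  (ha : lower_solution T f g a1 a2)
  (hb : upper_solution T f g b1 b2)
  (hN : nagumo_condition T f g (shift_down T a1) (shift_up T b1)
          (shift_down T a2) (shift_up T b2))
  (hi : forall t z0 z1 w1, Icc T t ->
     Rmin (min_Icc T (Derive_Icc T a1)) (min_Icc T (Derive_Icc T b1)) <= z1 <=
     Rmax (max_Icc T (Derive_Icc T a1)) (max_Icc T (Derive_Icc T b1)) ->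
     forall w0 w0', w0 <= w0' -> f t z0 w0' z1 w1 <= f t z0 w0 z1 w1)
  (hii : forall t w0 z1 w1, Icc T t ->
     Rmin (min_Icc T (Derive_Icc T a2)) (min_Icc T (Derive_Icc T b2)) <= w1 <=
     Rmax (max_Icc T (Derive_Icc T a2)) (max_Icc T (Derive_Icc T b2)) ->
     forall z0 z0', z0 <= z0' -> g t z0' w0 z1 w1 <= g t z0 w0 z1 w1) :
  exists z w : R -> R,
    C2_Icc T z /\ C2_Icc T w /\ periodic_solution T f g z w /\
    forall t, Icc T t ->
      shift_down T a1 t <= z t <= shift_up T b1 t /\
      shift_down T a2 t <= w t <= shift_up T b2 t.
Proof.
  destruct ha as [[Da1 Ca1] [[Da2 Ca2] [Ta1 [Ta2 [Ha [Pa1 [Pa1' [Pa2 Pa2']]]]]]]].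
  destruct hb as [[Db1 Cb1] [[Db2 Cb2] [Tb1 [Tb2 [Hb [Pb1 [Pb1' [Pb2 Pb2']]]]]]]].
  destruct hN as [phi [psi [Hphi [Hpsi Hbound]]]].
  assert (hT' : 0 <= T) by lra.
  assert (I0 : Icc T 0) by (unfold Icc; lra).
  assert (D1 : forall u t, twice_derivable_Icc T u -> Icc T t ->
    is_derive_Icc T u t (Derive_Icc T u t)).
  { intros u t Hu Ht. apply ex_derive_Icc_correct; auto. apply Hu, Ht. }
  assert (D2 : forall u t, twice_derivable_Icc T u -> Icc T t ->
    is_derive_Icc T (Derive_Icc T u) t (Derive_Icc T (Derive_Icc T u) t)).
  { intros u t Hu Ht. apply ex_derive_Icc_correct; auto. apply Hu, Ht. }
  assert (Cont : forall u, (forall t, Icc T t -> ex_derive_Icc T u t) ->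
    bounded_by T (norm_Icc T u) u /\
    continuous_on (Icc T) (shift_down T u) /\ continuous_on (Icc T) (shift_up T u)).
  { intros u Hu. split; [|split].
    - apply norm_Icc_bound, ex_derive_Icc_continuous; assumption.
    - apply ex_derive_Icc_continuous. intros t Ht. destruct (Hu t Ht) as [l Hl].
      exists l. apply is_derive_Icc_plus_const, Hl.
    - apply ex_derive_Icc_continuous. intros t Ht. destruct (Hu t Ht) as [l Hl].
      exists l. apply is_derive_Icc_plus_const, Hl. }
  destruct (Cont a1 Da1) as [Na1 [CA1 _]]. destruct (Cont a2 Da2) as [Na2 [CA2 _]].
  destruct (Cont b1 Db1) as [Nb1 [_ CB1]]. destruct (Cont b2 Db2) as [Nb2 [_ CB2]].
  assert (Na1' := norm_Icc_bound T _ hT' Ca1). assert (Na2' := norm_Icc_bound T _ hT' Ca2).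
  assert (Nb1' := norm_Icc_bound T _ hT' Cb1). assert (Nb2' := norm_Icc_bound T _ hT' Cb2).
  assert (Pos : forall K u, bounded_by T K u -> 0 <= K).
  { intros K u H. eapply Rle_trans; [apply Rabs_pos|apply (H 0 I0)]. }
  assert (Q1 := Pos _ _ Na1). assert (Q2 := Pos _ _ Na2).
  assert (Q3 := Pos _ _ Nb1). assert (Q4 := Pos _ _ Nb2).
  assert (Q1' := Pos _ _ Na1'). assert (Q2' := Pos _ _ Na2').
  assert (Q3' := Pos _ _ Nb1'). assert (Q4' := Pos _ _ Nb2').
  destruct (nagumo_function_large phi T Hphi) as [N1 HN1].
  destruct (nagumo_function_large psi T Hpsi) as [N2 HN2].
  (* N must exceed both Nagumo thresholds and dominate the derivatives of the lower and upper
     solutions, so that truncation leaves those derivatives unchanged. *)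
  assert (HNex : exists N, 0 <= N /\ N1 < N /\ N2 < N /\
    norm_Icc T (Derive_Icc T a1) <= N /\ norm_Icc T (Derive_Icc T a2) <= N /\
    norm_Icc T (Derive_Icc T b1) <= N /\ norm_Icc T (Derive_Icc T b2) <= N).
  { exists (Rabs N1 + Rabs N2 + 1 + norm_Icc T (Derive_Icc T a1) + norm_Icc T (Derive_Icc T a2)
      + norm_Icc T (Derive_Icc T b1) + norm_Icc T (Derive_Icc T b2)).
    assert (X1 := Rle_abs N1). assert (X2 := Rle_abs N2).
    assert (X3 := Rabs_pos N1). assert (X4 := Rabs_pos N2). repeat split; lra. }
  destruct HNex as [N [HN0 [HNN1 [HNN2 [Ga1 [Ga2 [Gb1 Gb2]]]]]]].
  set (A1 := shift_down T a1) in *. set (A2 := shift_down T a2) in *.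
  set (B1 := shift_up T b1) in *. set (B2 := shift_up T b2) in *.
  set (C := 2 * (norm_Icc T a1 + norm_Icc T a2 + norm_Icc T b1 + norm_Icc T b2)).
  (* The shifts by the norms give alpha^0 <= 0 <= beta^0, which orders the barriers although alpha
     and beta themselves are not ordered. *)
  assert (Sgn : forall t, Icc T t -> - C <= A1 t <= 0 /\ - C <= A2 t <= 0 /\
                                     0 <= B1 t <= C /\ 0 <= B2 t <= C).
  { intros t Ht. unfold A1, A2, B1, B2, shift_down, shift_up, C.
    assert (X1 := proj1 (Rabs_le_between _ _) (Na1 t Ht)).
    assert (X2 := proj1 (Rabs_le_between _ _) (Na2 t Ht)).
    assert (X3 := proj1 (Rabs_le_between _ _) (Nb1 t Ht)).
    assert (X4 := proj1 (Rabs_le_between _ _) (Nb2 t Ht)). lra. }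
  assert (Hle : forall t, Icc T t -> A1 t <= B1 t /\ A2 t <= B2 t).
  { intros t Ht. generalize (Sgn t Ht); lra. }
  assert (Reg : forall k, continuous_rhs T k ->
    uniform_rhs T (trunc_rhs k A1 B1 A2 B2 N) /\
    exists M, forall t z0 w0 z1 w1, Icc T t ->
      Rabs (trunc_rhs k A1 B1 A2 B2 N t z0 w0 z1 w1) <= M).
  { intros k Hk. apply (trunc_rhs_regular T k A1 B1 A2 B2 N C); auto;
      intros t Ht; apply Rabs_le_between; generalize (Sgn t Ht); lra. }
  assert (Pz : continuous_rhs T (fun _ z0 _ _ _ => z0)).
  { intros [[[[t z0] w0] z1] w1] _ V [e HV]. exists e.
    intros [[[[t' z0'] w0'] z1'] w1'] [[[[_ Hz] _] _] _] _. apply HV, Hz. }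
  assert (Pw : continuous_rhs T (fun _ _ w0 _ _ => w0)).
  { intros [[[[t z0] w0] z1] w1] _ V [e HV]. exists e.
    intros [[[[t' z0'] w0'] z1'] w1'] [[[_ Hw] _] _] _. apply HV, Hw. }
  (* Truncating f - z and g - w, and adding z and w back in [periodic_regularized], produces the
     penalties z - proj z and w - proj w. *)
  destruct (Reg _ (continuous_rhs_minus T f _ hf Pz)) as [UF [MF HMF]].
  destruct (Reg _ (continuous_rhs_minus T g _ hg Pw)) as [UG [MG HMG]].
  destruct (periodic_regularized T _ _ MF MG hT UF UG HMF HMG)
    as [z [z1 [w [w1 [[Ez [Ez1 [Ew Ew1]]] Hzw]]]]].
  unfold trunc_rhs in Hzw.
  assert (Range : forall a b t, continuous_on (Icc T) a -> continuous_on (Icc T) b -> Icc T t ->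
    forall p, p = a t \/ p = b t ->
    Rmin (min_Icc T a) (min_Icc T b) <= p <= Rmax (max_Icc T a) (max_Icc T b)).
  { intros a b t Hac Hbc Ht p Hp.
    assert (X1 := proj2 (min_Icc_spec T a hT' Hac) t Ht).
    assert (X2 := proj2 (max_Icc_spec T a hT' Hac) t Ht).
    assert (X3 := proj2 (min_Icc_spec T b hT' Hbc) t Ht).
    assert (X4 := proj2 (max_Icc_spec T b hT' Hbc) t Ht).
    assert (Y1 := Rmin_l (min_Icc T a) (min_Icc T b)).
    assert (Y2 := Rmin_r (min_Icc T a) (min_Icc T b)).
    assert (Y3 := Rmax_l (max_Icc T a) (max_Icc T b)).
    assert (Y4 := Rmax_r (max_Icc T a) (max_Icc T b)).
    destruct Hp as [-> | ->]; lra. }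
  assert (Bz : forall t, Icc T t -> A1 t <= z t <= B1 t).
  { apply (solution_between T N f A1 (Derive_Icc T a1) (Derive_Icc T (Derive_Icc T a1))
      B1 (Derive_Icc T b1) (Derive_Icc T (Derive_Icc T b1)) A2 B2 z z1 w w1); auto.
    - intros; apply Hzw; assumption.
    - intros; apply Hzw; assumption.
    - intros; apply is_derive_Icc_plus_const; auto.
    - unfold A1, shift_down; congruence.
    - intros t q Ht. apply Ha, Ht.
    - intros; apply is_derive_Icc_plus_const; auto.
    - unfold B1, shift_up; congruence.
    - intros t q Ht. apply Hb, Ht.
    - intros t Ht. split; eapply Rle_trans; [apply Na1', Ht|exact Ga1|apply Nb1', Ht|exact Gb1].
    - intros t p0 p1 q1 Ht Hp. apply hi; [exact Ht|]. apply (Range _ _ t); auto. }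
  assert (Bw : forall t, Icc T t -> A2 t <= w t <= B2 t).
  (* The same comparison for w, with the roles of (z, f) and (w, g) exchanged. *)
  { apply (solution_between T N (fun t w0 z0 w1 z1 => g t z0 w0 z1 w1)
      A2 (Derive_Icc T a2) (Derive_Icc T (Derive_Icc T a2))
      B2 (Derive_Icc T b2) (Derive_Icc T (Derive_Icc T b2)) A1 B1 w w1 z z1); auto.
    - intros; apply Hzw; assumption.
    - intros; apply Hzw; assumption.
    - intros; apply is_derive_Icc_plus_const; auto.
    - unfold A2, shift_down; congruence.
    - intros t q Ht. apply Ha, Ht.
    - intros; apply is_derive_Icc_plus_const; auto.
    - unfold B2, shift_up; congruence.
    - intros t q Ht. apply Hb, Ht.
    - intros t Ht. apply and_comm, Hle, Ht.
    - intros t Ht. split; eapply Rle_trans; [apply Na2', Ht|exact Ga2|apply Nb2', Ht|exact Gb2].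
    - intros t p0 p1 q1 Ht Hp q0 q0' Hq. apply hii; [exact Ht| |exact Hq].
      apply (Range _ _ t); auto. }
  set (F := fun t => f t (z t) (w t) (clamp (- N) N (z1 t)) (clamp (- N) N (w1 t))).
  set (G := fun t => g t (z t) (w t) (clamp (- N) N (z1 t)) (clamp (- N) N (w1 t))).
  assert (Dz : forall t, Icc T t -> is_derive_Icc T z t (z1 t)) by (intros; apply Hzw; auto).
  assert (Dw : forall t, Icc T t -> is_derive_Icc T w t (w1 t)) by (intros; apply Hzw; auto).
  (* Between the barriers the projections of z and w are the identity and the penalty disappears;
     only the truncation of the derivatives remains. *)
  assert (Dz1 : forall t, Icc T t -> is_derive_Icc T z1 t (F t)).
  { intros t Ht. destruct (Hzw t Ht) as [_ [H _]].
    rewrite !(clamp_id _ _ (z t)), !(clamp_id _ _ (w t)) in H by auto.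
    replace (F t) with (z t + (F t - z t)) by ring. exact H. }
  assert (Dw1 : forall t, Icc T t -> is_derive_Icc T w1 t (G t)).
  { intros t Ht. destruct (Hzw t Ht) as [_ [_ [_ H]]].
    rewrite !(clamp_id _ _ (z t)), !(clamp_id _ _ (w t)) in H by auto.
    replace (G t) with (w t + (G t - w t)) by ring. exact H. }
  assert (Kz : forall t, Icc T t -> - N < z1 t < N).
  { apply (nagumo_bound T N phi z z1 F); auto.
    intros t Ht. apply Hbound; auto. }
  assert (Kw : forall t, Icc T t -> - N < w1 t < N).
  { apply (nagumo_bound T N psi w w1 G); auto.
    intros t Ht. apply Hbound; auto. }
  (* The Nagumo bounds now remove the truncation of the derivatives as well. *)
  assert (EF : forall t, Icc T t -> F t = f t (z t) (w t) (z1 t) (w1 t) /\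
                                   G t = g t (z t) (w t) (z1 t) (w1 t)).
  { intros t Ht. assert (X1 := Kz t Ht). assert (X2 := Kw t Ht).
    unfold F, G. rewrite !clamp_id by lra. auto. }
  assert (cz : continuous_on (Icc T) z)
    by (apply ex_derive_Icc_continuous; intros t Ht; exists (z1 t); auto).
  assert (cw : continuous_on (Icc T) w)
    by (apply ex_derive_Icc_continuous; intros t Ht; exists (w1 t); auto).
  assert (cz1 : continuous_on (Icc T) z1)
    by (apply ex_derive_Icc_continuous; intros t Ht; exists (F t); auto).
  assert (cw1 : continuous_on (Icc T) w1)
    by (apply ex_derive_Icc_continuous; intros t Ht; exists (G t); auto).
  destruct (C2_Icc_intro T z z1 (fun t => f t (z t) (w t) (z1 t) (w1 t)) hT Dz)
    as [C2z [Ez' Ez'']].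
  { intros t Ht. rewrite <- (proj1 (EF t Ht)). auto. }
  { apply continuous_rhs_comp; assumption. }
  destruct (C2_Icc_intro T w w1 (fun t => g t (z t) (w t) (z1 t) (w1 t)) hT Dw)
    as [C2w [Ew' Ew'']].
  { intros t Ht. rewrite <- (proj2 (EF t Ht)). auto. }
  { apply continuous_rhs_comp; assumption. }
  assert (IT : Icc T T) by (unfold Icc; lra).
  exists z, w. split; [exact C2z|]. split; [exact C2w|]. split.
  - split.
    + intros t Ht. rewrite Ez'', Ew'', Ez', Ew' by assumption. auto.
    + rewrite !Ez', !Ew' by assumption. auto.
  - intros t Ht. split; [apply Bz, Ht|apply Bw, Ht].
Qed.
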